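(* Let $G$ be an $S_{2,2,4}$-free bipartite graph with $n$ vertices. Then the Efficient Domination problem for $G$ can be solved in time $O(n^6)$.
   Context: For a graph $G=(V,E)$ and $v\in V$, $N[v]$ is the closed neighborhood of $v$. A set $D\subseteq V$ is an efficient dominating set (e.d.s.) if $|N[v]\cap D|=1$ for every $v\in V$; the Efficient Domination problem asks whether $G$ has an e.d.s. For $i,j,k\ge 0$, $S_{i,j,k}$ is the graph with vertices $u,x_1,\dots,x_i,y_1,\dots,y_j,z_1,\dots,z_k$ whose edges are exactly those of the three paths $u,x_1,\dots,x_i$; $u,y_1,\dots,y_j$; $u,z_1,\dots,z_k$ (a subdivided claw with center $u$). A graph is $H$-free if it has no induced subgraph isomorphic to $H$. *)

(* Defs.v *)
From mathcomp Require Import all_boot.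

Set Implicit Arguments.
Unset Strict Implicit.
Unset Printing Implicit Defensive.

Section Graphs.

Variable T : finType.
Implicit Type e : rel T.

Definition simple_graph e : Prop := symmetric e /\ irreflexive e.

Definition bipartite e : Prop :=
  exists A : {set T}, forall x y, e x y -> (x \in A) != (y \in A).

Definition closed_nbhd e (v : T) : {set T} := [set w | (w == v) || e v w].

Definition efficient_dominating_set e (D : {set T}) : Prop :=
  forall v, #|closed_nbhd e v :&: D| = 1.

Definition has_eds e : Prop := exists D, efficient_dominating_set e D.

Definition induced_free (S : finType) (h : rel S) e : Prop :=
  ~ exists f : S -> T, injective f /\ forall x y, e (f x) (f y) = h x y.

End Graphs.

(* [None] is the center u; the summands are x_1..x_i, y_1..y_j and z_1..z_k,
   shifted to indices starting at 0. *)
Definition spider_vertex (i j k : nat) : finType :=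
  option ('I_i + 'I_j + 'I_k)%type.

(* The edges of S_{i,j,k}, oriented away from the center. *)
Definition spider_arc (i j k : nat) (v w : spider_vertex i j k) : bool :=
  match v, w with
  | None, Some (inl (inl b)) => b == 0 :> nat
  | None, Some (inl (inr b)) => b == 0 :> nat
  | None, Some (inr b) => b == 0 :> nat
  | Some (inl (inl a)), Some (inl (inl b)) => b == a.+1 :> nat
  | Some (inl (inr a)), Some (inl (inr b)) => b == a.+1 :> nat
  | Some (inr a), Some (inr b) => b == a.+1 :> nat
  | _, _ => false
  end.

Definition spider (i j k : nat) : rel (spider_vertex i j k) :=
  [rel v w | spider_arc v w || spider_arc w v].
Arguments spider : clear implicits.

(* Running time is measured on a word RAM: finitely many registers (those the
   program mentions) and an addressable memory, every cell holding a word,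
   i.e. a natural number below a bound W, with unit-cost word operations.
   Control flow is structured.  A run in which a value reaches W is stuck: it
   has no [exec] derivation. *)
Inductive word_op := OpAdd | OpSub | OpMul | OpDiv | OpMod | OpEq | OpLt.

Definition apply_op (o : word_op) (a b : nat) : nat :=
  match o with
  | OpAdd => a + b
  | OpSub => a - b
  | OpMul => a * b
  | OpDiv => a %/ b
  | OpMod => a %% b
  | OpEq => a == b
  | OpLt => a < b
  end.

Inductive expr :=
  | Const of nat
  | Reg of nat
  | Read of expr
  | Op of word_op & expr & expr.

Inductive cmd :=
  | Skip
  | Assign of nat & expr
  | Write of expr & expr
  | Seq of cmd & cmd
  | If of expr & cmd & cmd
  | While of expr & cmd.

Record state := State { regs : nat -> nat; mem : nat -> nat }.

Definition update (f : nat -> nat) (a v : nat) : nat -> nat :=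
  fun b => if b == a then v else f b.

Definition set_reg (s : state) x v := State (update (regs s) x v) (mem s).
Definition set_mem (s : state) a v := State (regs s) (update (mem s) a v).

Definition word (W v : nat) : option nat := if v < W then Some v else None.

Fixpoint eval (W : nat) (s : state) (E : expr) : option nat :=
  match E with
  | Const v => word W v
  | Reg x => word W (regs s x)
  | Read A => if eval W s A is Some a then word W (mem s a) else None
  | Op o A B =>
      match eval W s A, eval W s B with
      | Some a, Some b => word W (apply_op o a b)
      | _, _ => None
      end
  end.

Fixpoint cost (E : expr) : nat :=
  match E with
  | Const _ | Reg _ => 1
  | Read A => (cost A).+1
  | Op _ A B => (cost A + cost B).+1
  end.

(* [exec W c s t s'] : with word bound W, command c started in state s halts
   in state s' after t time units. *)
Inductive exec (W : nat) : cmd -> state -> nat -> state -> Prop :=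
  | exec_skip s : exec W Skip s 1 s
  | exec_assign x E s v :
      eval W s E = Some v -> exec W (Assign x E) s (cost E).+1 (set_reg s x v)
  | exec_write A E s a v :
      eval W s A = Some a -> eval W s E = Some v ->
      exec W (Write A E) s (cost A + cost E).+1 (set_mem s a v)
  | exec_seq c1 c2 s s1 s2 t1 t2 :
      exec W c1 s t1 s1 -> exec W c2 s1 t2 s2 ->
      exec W (Seq c1 c2) s (t1 + t2) s2
  | exec_if E c1 c2 s v t s' :
      eval W s E = Some v -> exec W (if v != 0 then c1 else c2) s t s' ->
      exec W (If E c1 c2) s ((cost E).+1 + t) s'
  | exec_while_end E c s :
      eval W s E = Some 0 -> exec W (While E c) s (cost E).+1 s
  | exec_while_step E c s v s1 s2 t1 t2 :
      eval W s E = Some v -> v != 0 ->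
      exec W c s t1 s1 -> exec W (While E c) s1 t2 s2 ->
      exec W (While E c) s ((cost E).+1 + t1 + t2) s2.

(* Input: n in register 0, the adjacency matrix row by row in memory cells
   0 .. n^2 - 1, zero elsewhere. *)
Definition adj_mem (n : nat) (e : rel 'I_n) (a : nat) : nat :=
  [exists i : 'I_n, exists j : 'I_n, (a == i * n + j) && e i j].

Definition input (n : nat) (e : rel 'I_n) : state :=
  State (fun x => if x == 0 then n else 0) (adj_mem e).

(* The word bound (n + 2)^k means words of k log2(n + 2) = O(log n) bits.
   The answer is read off register 0.  Nothing is required of the program on
   graphs outside the class C. *)
Definition solves_in_time (C Q : forall n : nat, rel 'I_n -> Prop)
    (p : cmd) (k : nat) (t : nat -> nat) : Prop :=
  forall (n : nat) (e : rel 'I_n), simple_graph e -> C n e ->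
    exists (m : nat) (s : state),
      [/\ exec ((n + 2) ^ k) p (input e) m s, m <= t n
        & regs s 0 <> 0 <-> Q n e].

Definition bigO (f g : nat -> nat) : Prop :=
  exists c n0 : nat, forall n, n0 <= n -> f n <= c * g n.

(* Some fixed program decides Q on all simple graphs of class C in time
   O(f(n)), n being the number of vertices. *)
Definition solvable_in_time (C Q : forall n : nat, rel 'I_n -> Prop)
    (f : nat -> nat) : Prop :=
  exists (p : cmd) (k : nat) (t : nat -> nat),
    bigO t f /\ solves_in_time C Q p k t.

(* Main.v *)
From Stdlib Require Import Classical.
From mathcomp Require Import all_boot zify.
Require Import Defs.

Set Implicit Arguments.
Unset Strict Implicit.
Unset Printing Implicit Defensive.

(* Let D be an e.d.s. and R a subset of D, and take breadth-first levels from
   R.  Going through the vertices w level by level, an undominated w must be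
   dominated by a vertex one level further out.  If d in D dominates w and v
   is another candidate, then v has a private neighbour b in D further out; if
   d also has a private neighbour a further out, then w is the center of an
   induced path a d w v b, called a fork below.  Without forks d is the
   candidate with the fewest neighbours further out, and D is recovered from R
   greedily in time O(n^2).

   A fork together with an induced path of four more vertices leaving w
   towards the roots is an S_{2,2,4}.  Hence forks occur only close to R, and
   each fork that does occur yields new members of D at distance 3 from old
   ones, which serve as further roots.  At most four roots are needed before
   forks become impossible, so the algorithm tries all n^4 choices of R. *)

(** * Bounded-loop programs *)

Inductive prog :=
  | PSkip
  | PSet of nat & expr
  | PPut of nat & expr & expr
  | PSeq of prog & prog
  | PIf of expr & prog & prog
  | PFor of nat & prog.

(* Eight arrays are interleaved above the adjacency matrix: entry i of array j
   lies at n^2 + 8 i + j, so distinct arrays never collide, even when an index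
   is out of range. *)
Definition addr (j : nat) (X : expr) : expr :=
  Op OpAdd (Op OpAdd (Op OpMul (Reg 0) (Reg 0)) (Op OpMul (Const 8) X)) (Const j).

Definition Cell (j : nat) (X : expr) : expr := Read (addr j X).

Definition loop_test (x : nat) : expr := Op OpLt (Reg x) (Reg 0).
Definition succ_reg (x : nat) : expr := Op OpAdd (Reg x) (Const 1).

Fixpoint compile (p : prog) : cmd :=
  match p with
  | PSkip => Skip
  | PSet x E => Assign x E
  | PPut j X E => Write (addr j X) E
  | PSeq p q => Seq (compile p) (compile q)
  | PIf E p q => If E (compile p) (compile q)
  | PFor x p =>
      Seq (Assign x (Const 0))
        (While (loop_test x) (Seq (compile p) (Assign x (succ_reg x))))
  end.

Fixpoint ev (s : state) (E : expr) : nat :=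
  match E with
  | Const v => v
  | Reg x => regs s x
  | Read A => mem s (ev s A)
  | Op o A B => apply_op o (ev s A) (ev s B)
  end.

Fixpoint sem (p : prog) (s : state) : state :=
  match p with
  | PSkip => s
  | PSet x E => set_reg s x (ev s E)
  | PPut j X E => set_mem s (ev s (addr j X)) (ev s E)
  | PSeq p q => sem q (sem p s)
  | PIf E p q => if ev s E != 0 then sem p s else sem q s
  | PFor x p =>
      iter (regs s 0) (fun s' => set_reg (sem p s') x (regs (sem p s') x + 1))
        (set_reg s x 0)
  end.

Fixpoint time (n : nat) (p : prog) : nat :=
  match p with
  | PSkip => 1
  | PSet x E => (cost E).+1
  | PPut j X E => (cost (addr j X) + cost E).+1
  | PSeq p q => time n p + time n q
  | PIf E p q => (cost E).+1 + (time n p + time n q)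
  | PFor x p => 6 + n * (time n p + 8)
  end.

Fixpoint depth (p : prog) : nat :=
  match p with
  | PSeq p q | PIf _ p q => maxn (depth p) (depth q)
  | PFor _ p => (depth p).+1
  | _ => 0
  end.

Fixpoint max_cost (p : prog) : nat :=
  match p with
  | PSkip => 0
  | PSet x E => cost E
  | PPut j X E => maxn (cost (addr j X)) (cost E)
  | PSeq p q => maxn (max_cost p) (max_cost q)
  | PIf E p q => maxn (cost E) (maxn (max_cost p) (max_cost q))
  | PFor x p => maxn 3 (max_cost p)
  end.

Fixpoint assigns (x : nat) (p : prog) : bool :=
  match p with
  | PSet y _ => x == y
  | PSeq p q | PIf _ p q => assigns x p || assigns x q
  | PFor y p => (x == y) || assigns x p
  | _ => false
  end.

Fixpoint writes (j : nat) (p : prog) : bool :=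
  match p with
  | PPut k _ _ => j == k
  | PSeq p q | PIf _ p q => writes j p || writes j q
  | PFor _ p => writes j p
  | _ => false
  end.

Fixpoint small (E : expr) : bool :=
  match E with
  | Const v => v <= 8
  | Reg _ => true
  | Read A => small A
  | Op _ A B => small A && small B
  end.

Definition atomic (E : expr) : bool := if E is Op _ _ _ then false else true.

Definition bit (E : expr) : bool :=
  match E with
  | Const v => v <= 1
  | Op OpEq _ _ | Op OpLt _ _ => true
  | _ => false
  end.

(* Expressions whose value exceeds the largest stored value by at most 1. *)
Definition tame (E : expr) : bool :=
  [|| atomic E, bit E | if E is Op OpAdd A B then atomic A && bit B else false].

Fixpoint wf (p : prog) : bool :=
  match p with
  | PSkip => true
  | PSet x E => [&& x != 0, small E & tame E]
  | PPut j X E => [&& j < 8, small X, small E & tame E]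
  | PSeq p q => wf p && wf q
  | PIf E p q => [&& small E, wf p & wf q]
  | PFor x p => [&& x != 0, ~~ assigns x p & wf p]
  end.

Lemma sem_reg_unassigned y p s : ~~ assigns y p -> regs (sem p s) y = regs s y.
Proof.
elim: p s => //=.
- by move=> x E s; rewrite /update => /negbTE->.
- by move=> p IHp q IHq s; rewrite negb_or => /andP[/IHp Hp /IHq->].
- move=> E p IHp q IHq s; rewrite negb_or => /andP[/IHp Hp /IHq Hq].
  by case: ifP.
move=> x p IHp s; rewrite negb_or => /andP[yx /IHp Hp].
elim: (regs s 0) => [|k IHk] /=; first by rewrite /update (negbTE yx).
by rewrite {1}/update (negbTE yx) Hp.
Qed.

Lemma wf_assigns0 p : wf p -> ~~ assigns 0 p.
Proof.
elim: p => //= [x E|p IHp q IHq|E p IHp q IHq|x p IHp].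
- by rewrite eq_sym => /and3P[].
- by case/andP=> /IHp/negbTE-> /IHq/negbTE->.
- by case/and3P=> _ /IHp/negbTE-> /IHq/negbTE->.
- by case/and3P=> x0 _ /IHp/negbTE->; rewrite eq_sym (negbTE x0).
Qed.

Lemma sem_reg0 p s : wf p -> regs (sem p s) 0 = regs s 0.
Proof. by move=> /wf_assigns0; apply: sem_reg_unassigned. Qed.

(** * Compilation to the word RAM *)

Definition bounded (s : state) (m : nat) : Prop :=
  [/\ 8 <= m, forall x, regs s x <= m & forall a, mem s a <= m].

Lemma bounded_le s m m' : bounded s m -> m <= m' -> bounded s m'.
Proof. by move=> [m8 rm mm] le; split=> [|x|a]; apply: leq_trans le. Qed.

Lemma bounded_set_reg s m x v :
  bounded s m -> v <= m -> bounded (set_reg s x v) m.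
Proof. by move=> [m8 rm mm] le; split=> // y /=; rewrite /update; case: eqP. Qed.

Lemma bounded_set_mem s m a v :
  bounded s m -> v <= m -> bounded (set_mem s a v) m.
Proof. by move=> [m8 rm mm] le; split=> // b /=; rewrite /update; case: eqP. Qed.

Definition fits (W m c : nat) : Prop := (m + 2) ^ c <= W.

Lemma fits_le W m c m' c' : fits W m c -> m' <= m -> c' <= c -> fits W m' c'.
Proof.
move=> fit lem lec; apply: leq_trans fit.
apply: leq_trans (_ : (m + 2) ^ c' <= _); last by rewrite leq_exp2l // addn2.
by case: c' {lec} => // c'; rewrite leq_exp2r // leq_add2r.
Qed.

Lemma addn_muln_lt_exp b c d x y : 1 < b -> x < b ^ c -> y < b ^ d ->
  x + y < b ^ (c + d).+1 /\ x * y < b ^ (c + d).+1.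
Proof.
move=> b2; rewrite expnS expnD; set p := _ ^ c; set q := _ ^ d => xp yq.
have xy := ltn_mul xp yq.
have pq : 2 * (p * q) <= b * (p * q) by rewrite leq_mul2r b2 orbT.
have p_le : p <= p * q by rewrite leq_pmulr // (leq_ltn_trans _ yq).
have q_le : q <= p * q by rewrite leq_pmull // (leq_ltn_trans _ xp).
by split; lia.
Qed.

Lemma ev_lt_exp s m E : bounded s m -> small E -> ev s E < (m + 2) ^ cost E.
Proof.
move=> [m8 rm mm].
have b2 : 1 < m + 2 by lia.
have pow_gt2 c : 0 < c -> m + 2 <= (m + 2) ^ c.
  by case: c => // c _; rewrite expnS leq_pmulr // expn_gt0 ltnW.
elim: E => [v|x|A IH|o A IHA B IHB] /=.
- by rewrite expn1; lia.
- by rewrite expn1; have := rm x; lia.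
- by have := mm (ev s A); have := pow_gt2 (cost A).+1; lia.
case/andP=> /IHA a_lt /IHB b_lt.
have [add_lt mul_lt] := addn_muln_lt_exp b2 a_lt b_lt.
have := leq_div (ev s A) (ev s B); have := leq_mod (ev s A) (ev s B).
have := pow_gt2 (cost A + cost B).+1.
by case: o => /=; lia.
Qed.

Lemma eval_ev W s m E :
  bounded s m -> small E -> fits W m (cost E) -> eval W s E = Some (ev s E).
Proof.
move=> bs.
have wordE F : small F -> fits W m (cost F) -> word W (ev s F) = Some (ev s F).
  by move=> sF fit; rewrite /word (leq_trans (ev_lt_exp bs sF) fit).
elim: E => [v|x|A IH|o A IHA B IHB] sE fit; try exact: wordE fit.
  rewrite /= IH //; first exact: (wordE (Read A)).
  exact: fits_le fit _ (leqnSn _).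
case/andP: (sE) => sA sB.
rewrite /= IHA ?IHB //; first exact: (wordE (Op o A B)).
  by apply: fits_le fit _ _; rewrite //= ltnW // ltnS leq_addl.
by apply: fits_le fit _ _; rewrite //= ltnW // ltnS leq_addr.
Qed.

Lemma ev_atomic s m E : bounded s m -> small E -> atomic E -> ev s E <= m.
Proof.
by move=> [m8 rm mm]; case: E => //= v v8 _; apply: leq_trans m8.
Qed.

Lemma ev_bit s E : bit E -> ev s E <= 1.
Proof. by case: E => //= -[] // A B _; apply: leq_b1. Qed.

Lemma ev_tame s m E : bounded s m -> small E -> tame E -> ev s E <= m.+1.
Proof.
move=> bs sE /or3P[/(ev_atomic bs sE)|/(ev_bit s)|]; first exact: leqW.
  by move/leq_trans; apply.
case: E sE => //= -[] // A B /andP[sA _] /andP[/(ev_atomic bs sA) a_le].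
by move/(ev_bit s) => b_le; rewrite -addn1 leq_add.
Qed.

(* A stored value grows by at most 1 per time unit, so a polynomial running
   time keeps all values, and hence all addresses, polynomially small. *)
Definition simulates (W : nat) (p : prog) : Prop := forall s m,
  let t := time (regs s 0) p in
  bounded s m -> fits W (m + t) (max_cost p) ->
  bounded (sem p s) (m + t) /\
  exists2 u, u <= t & exec W (compile p) s u (sem p s).

Lemma simulates_skip W : simulates W PSkip.
Proof.
move=> s m /= bs _; split; first exact: bounded_le bs (leq_addr _ _).
by exists 1 => //; apply: exec_skip.
Qed.

Lemma simulates_set W x E : wf (PSet x E) -> simulates W (PSet x E).
Proof.
case/and3P=> _ sE tE s m /= bs fit; split.
  apply: bounded_set_reg; first exact: bounded_le bs (leq_addr _ _).
  by have := ev_tame bs sE tE; lia.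
exists (cost E).+1 => //; apply: exec_assign; apply: (eval_ev bs) => //.
exact: fits_le fit (leq_addr _ _) _.
Qed.

Lemma simulates_put W j X E : wf (PPut j X E) -> simulates W (PPut j X E).
Proof.
case/and4P=> j8 sX sE tE s m /= bs fit; split.
  apply: bounded_set_mem; first exact: bounded_le bs (leq_addr _ _).
  by have := ev_tame bs sE tE; lia.
exists (cost (addr j X) + cost E).+1 => //.
apply: exec_write; apply: (eval_ev bs) => //=; first by rewrite sX ltnW.
  by apply: fits_le fit _ _ => /=; lia.
by apply: fits_le fit _ _ => /=; lia.
Qed.

Lemma simulates_seq W p q :
  wf p -> simulates W p -> simulates W q -> simulates W (PSeq p q).
Proof.
move=> wp simp simq s m /= bs fit.
have [|bp [t t_le ex_p]] := simp s m bs; first by apply: fits_le fit _ _; lia.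
have [|bq [u u_le ex_q]] := simq (sem p s) _ bp.
  by rewrite sem_reg0 //; apply: fits_le fit _ _; lia.
rewrite sem_reg0 // in bq u_le; split; first by rewrite addnA.
by exists (t + u); [apply: leq_add | apply: exec_seq ex_p ex_q].
Qed.

Lemma simulates_if W E p q :
  small E -> simulates W p -> simulates W q -> simulates W (PIf E p q).
Proof.
move=> sE simp simq s m /= bs fit.
have evE : eval W s E = Some (ev s E).
  by apply: (eval_ev bs) => //; apply: fits_le fit _ _; lia.
have [|bp [t t_le ex_p]] := simp s m bs; first by apply: fits_le fit _ _; lia.
have [|bq [u u_le ex_q]] := simq s m bs; first by apply: fits_le fit _ _; lia.
case v: (ev s E != 0).
  split; first by apply: bounded_le bp _; lia.
  by exists ((cost E).+1 + t); [lia | apply: exec_if evE _; rewrite v].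
split; first by apply: bounded_le bq _; lia.
by exists ((cost E).+1 + u); [lia | apply: exec_if evE _; rewrite v].
Qed.

Lemma exec_while_iter W x p n k s m :
    wf (PFor x p) -> simulates W p -> regs s 0 = n -> regs s x + k = n ->
    let T := time n p + 8 in
    let body := PSeq p (PSet x (succ_reg x)) in
    bounded s m -> fits W (m + k * T) (maxn 3 (max_cost p)) ->
  bounded (iter k (sem body) s) (m + k * T) /\
  exists2 t, t <= 4 + k * T &
    exec W (While (loop_test x) (compile body)) s t (iter k (sem body) s).
Proof.
case/and3P=> x0 xp wp simp; move=> s0 sx T body.
have wbody : wf body by rewrite /body /= x0 andbT.
have sim_body : simulates W body.
  by apply: simulates_seq => //; apply: simulates_set; rewrite /= x0.
elim: k s m s0 sx => [|k IHk] s m s0 sx bs fit.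
  split; first by rewrite addn0.
  exists 4 => //; apply: exec_while_end.
  rewrite (eval_ev bs) //=; first by rewrite s0 -sx addn0 ltnn.
  by apply: fits_le fit _ _; lia.
have [|b1 [t t_le ex_body]] := sim_body s m bs.
  by rewrite s0; apply: fits_le fit _ _; rewrite /= /T; lia.
rewrite s0 in b1 t_le; rewrite iterSr; set s1 := sem body s in b1 ex_body *.
have s10 : regs s1 0 = n by rewrite sem_reg0.
have s1x : regs s1 x + k = n.
  by rewrite -sx addnS -addSn /= /update eqxx sem_reg_unassigned // addn1.
have {}b1 : bounded s1 (m + T) by apply: bounded_le b1 _; rewrite /= /T; lia.
have [|b2 [u u_le ex_loop]] := IHk s1 _ s10 s1x b1; first by rewrite -addnA.
split; first by rewrite mulSn addnA.
exists ((cost (loop_test x)).+1 + t + u); first by move: t_le u_le; rewrite /= /T; lia.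
apply: (exec_while_step (v := 1)) ex_body ex_loop => //.
rewrite (eval_ev bs) //=; first by rewrite s0 -sx -addn1 leq_add2l.
by apply: fits_le fit _ _; lia.
Qed.

Lemma simulates_for W x p : wf (PFor x p) -> simulates W p -> simulates W (PFor x p).
Proof.
move=> wfx simp s m; case/and3P: (wfx) => x0 _ _ /= bs fit.
set n := regs s 0 in fit *.
have b0 : bounded (set_reg s x 0) m by apply: bounded_set_reg.
have [|||b1 [t t_le ex_loop]] := exec_while_iter (k := n) (n := n) wfx simp _ _ b0.
- by rewrite /= /update eq_sym (negbTE x0).
- by rewrite /= /update eqxx.
- by apply: fits_le fit _ _; lia.
split; first by apply: bounded_le b1 _; lia.
exists (2 + t); first lia.
apply: exec_seq ex_loop; apply: exec_assign.
by rewrite (eval_ev bs) //; apply: fits_le fit _ _ => /=; lia.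
Qed.

Lemma wf_simulates W p : wf p -> simulates W p.
Proof.
elim: p => [|x E|j X E|p IHp q IHq|E p IHp q IHq|x p IHp] wfp.
- exact: simulates_skip.
- exact: simulates_set.
- exact: simulates_put.
- by case/andP: wfp => wp wq; apply: simulates_seq wp (IHp wp) (IHq wq).
- by case/and3P: wfp => sE wp wq; apply: simulates_if sE (IHp wp) (IHq wq).
by apply: simulates_for => //; apply: IHp; case/and3P: wfp.
Qed.

Lemma time_le_depth p : exists K, forall n, time n p <= K * n.+1 ^ depth p.
Proof.
have mono K n a b : a <= b -> K * n.+1 ^ a <= K * n.+1 ^ b.
  by move=> le; rewrite leq_mul2l leq_pexp2l ?orbT.
have leD n K L d f g : f <= K * n.+1 ^ d -> g <= L * n.+1 ^ d ->
    f + g <= (K + L) * n.+1 ^ d.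
  by rewrite mulnDl; apply: leq_add.
elim: p => [|x E|j X E|p [K IHp] q [L IHq]|E p [K IHp] q [L IHq]|x p [K IHp]].
- by exists 1.
- by exists (cost E).+1 => n; rewrite expn0 muln1.
- by exists (cost (addr j X) + cost E).+1 => n; rewrite expn0 muln1.
- exists (K + L) => n; apply: (leD n).
    exact: leq_trans (IHp n) (mono _ _ _ _ (leq_maxl _ _)).
  exact: leq_trans (IHq n) (mono _ _ _ _ (leq_maxr _ _)).
- exists ((cost E).+1 + (K + L)) => n; apply: (leD n).
    by rewrite leq_pmulr // expn_gt0.
  apply: (leD n).
    exact: leq_trans (IHp n) (mono _ _ _ _ (leq_maxl _ _)).
  exact: leq_trans (IHq n) (mono _ _ _ _ (leq_maxr _ _)).
exists (14 + K) => n; rewrite /= expnS.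
have gt0 : 0 < n.+1 ^ depth p by rewrite expn_gt0.
by have := IHp n; nia.
Qed.

Lemma leq_poly_expn K d : exists k, forall n, K * n.+1 ^ d <= (n + 2) ^ k.
Proof.
exists (K + d) => n; rewrite addn2 expnD leq_mul //; last first.
  by case: d => // d; rewrite leq_exp2r.
by apply: leq_trans (ltnW (ltn_expl K (ltnSn 1))) _; case: K => // K; rewrite leq_exp2r.
Qed.

Lemma bigO_time p c : bigO (fun n => time n p + c) (fun n => n ^ depth p).
Proof.
have [K timeK] := time_le_depth p.
exists ((K + c) * 2 ^ depth p), 1 => n n1.
have gt0 : 0 < n.+1 ^ depth p by rewrite expn_gt0.
apply: leq_trans (_ : (K + c) * n.+1 ^ depth p <= _).
  by rewrite mulnDl leq_add // leq_pmulr.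
rewrite -mulnA leq_mul2l -expnMn; apply/orP; right.
by case: (depth p) => // d; rewrite leq_exp2r // mul2n -addnn -addn1 leq_add2l.
Qed.

Lemma bounded_input n (e : rel 'I_n) : bounded (input e) (n + 8).
Proof.
split=> [|x|a] /=; first exact: leq_addl.
  by case: eqP => // _; apply: leq_addr.
by rewrite /adj_mem (leq_trans (leq_b1 _)) // addn_gt0 orbT.
Qed.

Lemma solvable_by_prog (C Q : forall n, rel 'I_n -> Prop) (p : prog) (x : nat) :
    wf p ->
    (forall n (e : rel 'I_n), simple_graph e -> C n e ->
       (regs (sem p (input e)) x <> 0 <-> Q n e)) ->
  solvable_in_time C Q (fun n => n ^ depth p).
Proof.
move=> wfp correct; have [K timeK] := time_le_depth p.
have [k0 le_k0] := leq_poly_expn (K + 10) (depth p).+1.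
pose c := (max_cost p).+1.
exists (Seq (compile p) (Assign 0 (Reg x))), (k0 * c), (fun n => time n p + 2).
split=> [|n e simple_e Ce]; first exact: bigO_time.
have fit : fits ((n + 2) ^ (k0 * c)) (n + 8 + time n p) c.
  rewrite /fits expnM leq_exp2r //; apply: leq_trans (le_k0 n).
  have gt0 : 0 < n.+1 ^ depth p by rewrite expn_gt0.
  by have := timeK n; rewrite expnS; nia.
have [|b_end [t t_le ex]] := wf_simulates (W := (n + 2) ^ (k0 * c)) wfp (bounded_input e).
  exact: fits_le fit _ (leqnSn _).
set s := sem p (input e) in b_end ex *.
exists (t + 2), (set_reg s 0 (regs s x)); split.
- apply: exec_seq ex _; apply: exec_assign.
  by apply: (eval_ev b_end) => //; apply: fits_le fit _ _.
- by rewrite leq_add2r.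
- by rewrite /= /update eqxx; apply: correct.
Qed.

(** * Induced spiders *)

Section Spiders.

Variables (T : finType) (e : rel T).
Hypotheses (sym_e : symmetric e) (irr_e : irreflexive e).

Definition nonadj : rel T := fun x y => ~~ e x y.

Fixpoint induced_path (s : seq T) : bool :=
  if s is x :: s' then
    (if s' is y :: s'' then e x y && all (nonadj x) s'' else true) && induced_path s'
  else true.

Lemma induced_path_adj x0 s i j : induced_path s -> i < size s -> j < size s ->
  e (nth x0 s i) (nth x0 s j) = (j == i.+1) || (i == j.+1).
Proof.
have headE x s' k : induced_path (x :: s') -> k < size s' ->
    e x (nth x0 s' k) = (k == 0).
  case: s' => // y s'' /= /andP[/andP[xy /allP no] _].
  by case: k => [|k] //= ks; apply/negbTE/no/mem_nth.
elim: s i j => // x s IHs [|i] [|j] path_xs /=; rewrite ?ltnS ?eqSS => is_ js.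
- by rewrite irr_e.
- by rewrite headE ?orbF.
- by rewrite sym_e headE ?orFb.
by rewrite IHs //; case/andP: path_xs.
Qed.

Definition spider_pos i j k (x : spider_vertex i j k) : nat :=
  match x with
  | None => 0
  | Some (inl (inl a)) => a.+1
  | Some (inl (inr a)) => (i + a).+1
  | Some (inr a) => (i + j + a).+1
  end.

Lemma spider_pos_inj i j k : injective (@spider_pos i j k).
Proof.
move=> [[[[a a_lt]|[a a_lt]]|[a a_lt]]|] [[[[b b_lt]|[b b_lt]]|[b b_lt]]|] //= [] eq_ab;
  try by exfalso; lia.
- by congr (Some (inl (inl _))); apply: ord_inj.
- by congr (Some (inl (inr _))); apply: ord_inj => /=; lia.
by congr (Some (inr _)); apply: ord_inj => /=; lia.
Qed.

Lemma spider_legs_not_free i j k w sx sy sz :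
    size sx = i -> size sy = j -> size sz = k -> uniq (w :: sx ++ sy ++ sz) ->
    induced_path (w :: sx) -> induced_path (w :: sy) -> induced_path (w :: sz) ->
    allrel nonadj sx sy -> allrel nonadj sx sz -> allrel nonadj sy sz ->
  ~ induced_free (spider i j k) e.
Proof.
move=> size_x size_y size_z uniq_s path_x path_y path_z no_xy no_xz no_yz; apply.
pose f (x : spider_vertex i j k) : T :=
  match x with
  | None => w
  | Some (inl (inl a)) => nth w sx a
  | Some (inl (inr a)) => nth w sy a
  | Some (inr a) => nth w sz a
  end.
have pos_lt x : @spider_pos i j k x < size (w :: sx ++ sy ++ sz).
  by rewrite /= !size_cat size_x size_y size_z; case: x => [[[]|]|] //= [a a_lt] /=; lia.
have f_pos x : f x = nth w (w :: sx ++ sy ++ sz) (spider_pos x).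
  case: x => [[[]|]|] //= a; rewrite !nth_cat size_x ?size_y.
  - by rewrite ltn_ord.
  - by rewrite ltnNge leq_addr /= addKn ltn_ord.
  by rewrite ltnNge -addnA leq_addr /= addKn ltnNge leq_addr /= addKn.
exists f; split=> [x y|].
  by rewrite !f_pos => /eqP; rewrite nth_uniq // => /eqP/spider_pos_inj.
have lt_x (a : 'I_i) : a < size sx by rewrite size_x.
have lt_y (a : 'I_j) : a < size sy by rewrite size_y.
have lt_z (a : 'I_k) : a < size sz by rewrite size_z.
have centerE s a : induced_path (w :: s) -> a < size s ->
    e w (nth w s a) = (a == 0).
  by move=> path_s a_lt; rewrite (@induced_path_adj w (w :: s) 0 a.+1) // orbF.
have legE s a b : induced_path (w :: s) -> a < size s -> b < size s ->
    e (nth w s a) (nth w s b) = (b == a.+1) || (a == b.+1).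
  by case/andP=> _ path_s; apply: induced_path_adj.
have crossE s t a b : allrel nonadj s t -> a < size s -> b < size t ->
    e (nth w s a) (nth w t b) = false.
  by move/allrelP=> no a_lt b_lt; apply/negbTE/no; apply: mem_nth.
move=> [[[a|a]|a]|] [[[b|b]|b]|]; rewrite /spider /= ?orbF ?irr_e //.
all: by [exact: legE | exact: centerE | exact: crossE
  | rewrite sym_e; exact: centerE | rewrite sym_e; exact: crossE].
Qed.

Variable A : {set T}.
Hypothesis color : forall x y, e x y -> (x \in A) != (y \in A).

Lemma bipartite_spider224_not_free w v1 u1 v2 u2 p1 p2 p3 p4 :
    path e w [:: v1; u1] -> path e w [:: v2; u2] -> path e w [:: p1; p2; p3; p4] ->
    nonadj v1 u2 -> nonadj v2 u1 ->
    allrel nonadj [:: v1; v2] [:: p2; p4] -> allrel nonadj [:: u1; u2] [:: p1; p3] ->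
    nonadj w p3 -> nonadj p1 p4 ->
  ~ induced_free (spider 2 2 4) e.
Proof.
have flip x y : e x y -> (y \in A) = ~~ (x \in A).
  by move/color; case: (x \in A); case: (y \in A).
have same x y : (x \in A) = (y \in A) -> nonadj x y.
  by move=> xy; apply/negP => /color; rewrite xy eqxx.
rewrite /= !andbT => /andP[wv1 vu1] /andP[wv2 vu2] /and4P[wp1 p12 p23 p34].
rewrite /allrel /= !andbT => v1u2 v2u1.
move=> /andP[/andP[v1p2 v1p4] /andP[v2p2 v2p4]] /andP[/andP[u1p1 u1p3] /andP[u2p1 u2p3]].
move=> wp3 p14.
have cv1 := flip _ _ wv1; have cv2 := flip _ _ wv2; have cp1 := flip _ _ wp1.
move: (flip _ _ vu1) (flip _ _ vu2) (flip _ _ p12).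
rewrite cv1 cv2 cp1 negbK => cu1 cu2 cp2.
move: (flip _ _ p23) (flip _ _ p34); rewrite cp2 => cp3; rewrite cp3 negbK => cp4.
have sep_color x y : (x \in A) = ~~ (y \in A) -> x != y.
  by apply: contra_eq_neq => ->; case: (y \in A).
have sep x y z : e x z -> nonadj y z -> x != y.
  by move=> xz; apply: contraNneq => <-.
have sep_sym x y z : nonadj x z -> e y z -> x != y.
  by move=> xz yz; rewrite eq_sym; apply: sep yz xz.
have sym_adj x y : e x y -> e y x by rewrite sym_e.
have sym_nonadj x y : nonadj x y -> nonadj y x by rewrite /nonadj sym_e.
apply: (@spider_legs_not_free _ _ _ w [:: v1; u1] [:: v2; u2] [:: p1; p2; p3; p4]) => //.
all: rewrite ?inE ?negb_or /allrel /= ?inE ?negb_or ?andbT; do !(apply/andP; split) => //.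
(* Vertices of one colour are not adjacent, and any two of them are told apart
   by a vertex adjacent to exactly one. *)
all: first [ by apply: same; congruence
  | by apply: sep_color; rewrite ?cv1 ?cv2 ?cp1 ?cu1 ?cu2 ?cp2 ?cp3 ?cp4 ?negbK
  | by eauto 4 using sep, sep_sym, sym_adj, sym_nonadj ].
Qed.

End Spiders.

(** * Efficient dominating sets *)

Section Dominators.

Variables (T : finType) (e : rel T).
Hypotheses (sym_e : symmetric e) (irr_e : irreflexive e).

Local Notation "'N[' v ]" := (closed_nbhd e v) (format "'N[' v ]").

Lemma closed_nbhd_refl v : v \in N[v].
Proof. by rewrite inE eqxx. Qed.

Lemma closed_nbhd_adj u v : e u v -> v \in N[u].
Proof. by rewrite inE => ->; rewrite orbT. Qed.

Lemma closed_nbhd_sym u v : (u \in N[v]) = (v \in N[u]).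
Proof. by rewrite !inE eq_sym sym_e. Qed.

Definition dominators (P : {set T}) (t : T) : nat := #|N[t] :&: P|.

Lemma dominatorsU1 (P : {set T}) v t : v \notin P ->
  dominators (v |: P) t = dominators P t + (t \in N[v]).
Proof.
move=> vP; rewrite /dominators closed_nbhd_sym setIUr addnC.
have [vt|vt] := boolP (v \in N[t]).
  by rewrite (setIidPr _) ?sub1set // cardsU1 inE (negbTE vP) andbF.
by have /eqP-> : N[t] :&: [set v] == set0; rewrite ?set0U // setIC setI_eq0 disjoints1.
Qed.

Lemma dominators_gt0P (P : {set T}) t :
  reflect (exists2 d, d \in P & d \in N[t]) (0 < dominators P t).
Proof.
apply: (iffP card_gt0P) => [[d]|[d dP td]]; last by exists d; rewrite inE td.
by rewrite inE => /andP[td dP]; exists d.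
Qed.

Lemma dominators_eq0 (P : {set T}) t d :
  dominators P t = 0 -> d \in N[t] -> d \notin P.
Proof.
move=> undom dt; apply/negP => dP.
by have : 0 < dominators P t by [apply/dominators_gt0P; exists d]; rewrite undom.
Qed.

Lemma dominators_sub (P P' : {set T}) t :
  P \subset P' -> dominators P t <= dominators P' t.
Proof. by move=> PP'; apply/subset_leq_card/setIS. Qed.

Section EfficientDominatingSet.

Variable D : {set T}.
Hypothesis edsD : efficient_dominating_set e D.

Lemma eds_dominator t : exists2 d, d \in D & d \in N[t].
Proof. by apply/dominators_gt0P; rewrite /dominators edsD. Qed.

Lemma eds_uniq t a b : a \in D -> b \in D -> a \in N[t] -> b \in N[t] -> a = b.
Proof.
move=> aD bD ta tb; have /eqP/cards1P[z Nz] := edsD t.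
have /set1P-> : a \in [set z] by rewrite -Nz inE ta.
by have /set1P-> : b \in [set z] by rewrite -Nz inE tb.
Qed.

Lemma eds_nonadj t a b : a \in D -> b \in D -> a != b -> e t a -> e t b = false.
Proof.
move=> aD bD ab ta; apply: contraNF ab => tb.
by apply/eqP; apply: (eds_uniq (t := t)); rewrite ?closed_nbhd_adj.
Qed.

Lemma eds_indep a b : a \in D -> b \in D -> e a b = false.
Proof.
move=> aD bD; apply/negP => ab; suff ba : b = a by rewrite ba irr_e in ab.
by apply: (eds_uniq (t := a)); rewrite ?closed_nbhd_refl ?closed_nbhd_adj.
Qed.

Lemma dominators_sub_eds (P : {set T}) t :
  P \subset D -> 0 < dominators P t -> dominators P t = 1.
Proof. by move=> PD gt0; apply/eqP; rewrite eqn_leq gt0 andbT -(edsD t) dominators_sub. Qed.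

End EfficientDominatingSet.

Definition locally_dominated (v : T) : Prop := exists C P : {set T},
  [/\ v \in C, closed e C & forall t, t \in C -> dominators P t = 1].

Lemma local_to_global_eds : (forall v, locally_dominated v) -> has_eds e.
Proof.
move=> /fin_all_exists[C] /fin_all_exists[P locP].
have csym := sym_connect_sym sym_e.
exists [set v | v \in P (root e v)] => t.
have [rC clC domC] := locP (root e t).
have tC : t \in C (root e t) by rewrite (closed_connect clC (connect_root e t)).
rewrite -[RHS](domC t tC); apply: eq_card => x; rewrite !inE.
case N : (_ || _) => //=; suff -> : root e x = root e t by [].
apply/eqP; rewrite root_connect // csym.
by case/orP: N => [/eqP->|/connect1].
Qed.

End Dominators.

(** * Breadth-first levels and forks *)

Section Levels.

Variables (T : finType) (e : rel T).

(* Levels start at 1 on the root set; 0 marks the unreached vertices. *)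
Definition level_function (R : {set T}) (lev : T -> nat) : Prop :=
  [/\ forall v, (lev v == 1) = (v \in R),
      forall u v, e u v -> 0 < lev u -> 0 < lev v <= (lev u).+1
    & forall v, 1 < lev v -> exists2 u, e u v & (lev u).+1 = lev v].

(* That the path a d w v b is induced need not be required in full: [d] and [b]
   are not adjacent because both lie in [D], and the two vertices of any other
   omitted pair have the same colour. *)
Record fork (D : {set T}) (lev : T -> nat) (w d a v b : T) : Prop := Fork {
  fork_reached : 0 < lev w;
  fork_dominator : d \in D;
  fork_rival_dominator : b \in D;
  fork_wd : e w d;
  fork_wv : e w v;
  fork_da : e d a;
  fork_vb : e v b;
  fork_va : e v a = false;
  fork_lev_d : lev d = (lev w).+1;
  fork_lev_v : lev v = (lev w).+1;
  fork_lev_a : lev w < lev a;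
  fork_lev_b : lev w < lev b
}.

Definition unambiguous (D R : {set T}) : Prop :=
  forall lev w d a v b, level_function R lev -> ~ fork D lev w d a v b.

Lemma ambiguousP (D R : {set T}) : ~ unambiguous D R ->
  exists lev w d a v b, level_function R lev /\ fork D lev w d a v b.
Proof.
move=> amb; apply: NNPP => none; apply: amb => lev w d a v b lf fk.
by apply: none; exists lev, w, d, a, v, b.
Qed.

Definition linked (r s : T) : Prop := exists b c, [/\ e r b, e b c & e c s].

Definition paired (R : {set T}) : Prop :=
  forall r, r \in R -> exists2 s, s \in R & linked r s.

Definition covers (p s : T) : Prop := forall x, e s x -> e p x.

Definition remote (r s : T) : Prop := exists2 x, e s x & forall p, e r p -> e p x = false.

Hypotheses (sym_e : symmetric e) (irr_e : irreflexive e).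

Lemma linked_sym r s : linked r s -> linked s r.
Proof. by move=> [b [c [rb bc cs]]]; exists c, b; split; rewrite sym_e. Qed.

Section LevelFunction.

Variables (R : {set T}) (lev : T -> nat).
Hypothesis lf : level_function R lev.

Lemma level_root r : r \in R -> lev r = 1.
Proof. by case: lf => root _ _; rewrite -root => /eqP. Qed.

Lemma level1_root r : lev r = 1 -> r \in R.
Proof. by case: lf => root _ _; rewrite -root => ->. Qed.

Lemma level_step u v : e u v -> 0 < lev u -> 0 < lev v <= (lev u).+1.
Proof. by case: lf => _ + _; apply. Qed.

Lemma level_gt0 u v : e u v -> 0 < lev u -> 0 < lev v.
Proof. by move=> uv /(level_step uv)/andP[]. Qed.

Lemma level_root_nbr r b : r \in R -> e r b -> 0 < lev b <= 2.
Proof. by move=> /level_root r1 /level_step; rewrite r1; apply. Qed.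

Lemma level_gap u v : 0 < lev u -> (lev u).+1 < lev v -> e v u = false.
Proof.
move=> u0 uv; apply/negP; rewrite sym_e => /level_step/(_ u0)/andP[_].
by rewrite leqNgt uv.
Qed.

Lemma level_parent v k : lev v = k.+2 -> exists2 u, e v u & lev u = k.+1.
Proof.
case: lf => _ _ parent vk; have [|u uv uk] := parent v; first by rewrite vk.
by exists u; [rewrite sym_e | move: uk; rewrite vk => -[]].
Qed.

Lemma level_closed : closed e [set v | 0 < lev v].
Proof.
apply: intro_closed => [|u v uv]; first exact: sym_connect_sym.
by rewrite !inE; apply: level_gt0.
Qed.

Lemma connect_root_level v : 0 < lev v -> exists2 r, r \in R & connect e r v.
Proof.
move vk: (lev v) => k; elim: k v vk => // -[|k] IHk v vk _.
  by exists v => //; apply: level1_root.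
have [u vu uk] := level_parent vk; have [r rR ru] := IHk u uk isT.
by exists r => //; apply: connect_trans ru (connect1 _); rewrite sym_e.
Qed.

End LevelFunction.

Section Forks.

Hypothesis spider_free : induced_free (spider 2 2 4) e.
Variable A : {set T}.
Hypothesis color : forall x y, e x y -> (x \in A) != (y \in A).
Variable D : {set T}.
Hypothesis edsD : efficient_dominating_set e D.

Section SingleFork.

Variables (R : {set T}) (lev : T -> nat) (w d a v b : T).
Hypotheses (lf : level_function R lev) (RD : R \subset D).
Hypothesis fk : fork D lev w d a v b.

Lemma fork_low_chord p1 p2 p3 p4 :
    e w p1 -> e p1 p2 -> e p2 p3 -> e p3 p4 ->
    lev p1 < lev w -> lev p2 < lev w -> lev p3 < lev w -> lev p4 < lev w ->
  e w p3 || e p1 p4.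
Proof.
case: fk => w0 dD bD wd wv da vb va lev_d lev_v lev_a lev_b.
move=> wp1 p12 p23 p34 p1w p2w p3w p4w.
have gap x y : 0 < lev x -> lev x < lev w -> lev w < lev y -> nonadj e y x.
  by move=> x0 xw wy; rewrite /nonadj (level_gap lf) // (leq_ltn_trans xw).
have [wd' wv'] : lev w < lev d /\ lev w < lev v by rewrite lev_d lev_v.
have p1_gt0 := level_gt0 lf wp1 w0; have p2_gt0 := level_gt0 lf p12 p1_gt0.
have p3_gt0 := level_gt0 lf p23 p2_gt0; have p4_gt0 := level_gt0 lf p34 p3_gt0.
apply/norP=> -[wp3 p14].
apply: (bipartite_spider224_not_free sym_e irr_e color (w := w) (v1 := d) (u1 := a)
  (v2 := v) (u2 := b) (p1 := p1) (p2 := p2) (p3 := p3) (p4 := p4)) => //.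
- by rewrite /= wd da.
- by rewrite /= wv vb.
- by rewrite /= wp1 p12 p23 p34.
- by rewrite /nonadj (eds_indep irr_e edsD).
- by rewrite /nonadj va.
- by rewrite /allrel /= !gap.
by rewrite /allrel /= !gap.
Qed.

Lemma fork_level_le4 : lev w <= 4.
Proof.
case w_lev: (lev w) => [|[|[|[|[|k]]]]] //.
have [p1 wp1 lev_p1] := level_parent lf w_lev.
have [p2 p12 lev_p2] := level_parent lf lev_p1.
have [p3 p23 lev_p3] := level_parent lf lev_p2.
have [p4 p34 lev_p4] := level_parent lf lev_p3.
suff: e w p3 || e p1 p4.
  by rewrite !(level_gap lf) ?w_lev ?lev_p1 ?lev_p3 ?lev_p4 ?ltnS ?leqW.
apply: (fork_low_chord wp1 p12 p23 p34);
  by rewrite w_lev ?lev_p1 ?lev_p2 ?lev_p3 ?lev_p4 !ltnS ?leqW.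
Qed.

Lemma fork_level_gt2 : 2 < lev w.
Proof.
have no_root r : r \in R -> r \notin closed_nbhd e w.
  move=> rR; apply/negP => wr; have := level_root lf rR.
  rewrite (eds_uniq edsD (subsetP RD _ rR) (fork_dominator fk) wr).
    by rewrite (fork_lev_d fk) => -[w0]; have := fork_reached fk; rewrite w0.
  exact: closed_nbhd_adj (fork_wd fk).
case w_lev: (lev w) (fork_reached fk) => [|[|[|k]]] // _.
  by have := no_root w (level1_root lf w_lev); rewrite closed_nbhd_refl.
have [r wr r_lev] := level_parent lf w_lev.
by have := no_root r (level1_root lf r_lev); rewrite closed_nbhd_adj.
Qed.

Lemma fork_root_lt r : r \in R -> lev r < lev w.
Proof. by move=> /(level_root lf)->; apply: ltnW fork_level_gt2. Qed.

Lemma fork_root_nbr_lt r p : r \in R -> e r p -> lev p < lev w.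
Proof.
by move=> rR /(level_root_nbr lf rR)/andP[_] p_le; apply: leq_ltn_trans p_le fork_level_gt2.
Qed.

Lemma fork_root_nonadj r : r \in R -> e w r = false.
Proof. by move=> rR; rewrite (level_gap lf) ?(level_root lf rR) ?fork_level_gt2. Qed.

Lemma fork_covering_parent r s p : r \in R -> s \in R -> linked r s ->
  e r p -> e w p -> exists q, [/\ e r q, e w q & covers q s].
Proof.
move=> rR sR [b' [c [rb bc cs]]] rp wp; have sc : e s c by rewrite sym_e.
have complete q : e r q -> e w q -> e q c -> covers q s.
  move=> rq wq qc x sx; suff: e w s || e q x by rewrite fork_root_nonadj.
  apply: (fork_low_chord wq qc cs sx).
  - exact: fork_root_nbr_lt rq.
  - exact: fork_root_nbr_lt sc.
  - exact: fork_root_lt.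
  exact: fork_root_nbr_lt sx.
suff /orP[wb|pc] : e w b' || e p c.
- by exists b'; split=> //; apply: complete.
- by exists p; split=> //; apply: complete.
apply: (fork_low_chord wp _ rb bc); first by rewrite sym_e.
- exact: fork_root_nbr_lt rp.
- exact: fork_root_lt.
- exact: fork_root_nbr_lt rb.
exact: fork_root_nbr_lt sc.
Qed.

Lemma fork_away r s p : r \in R -> s \in R -> linked r s -> remote r s ->
  e r p -> e w p = false.
Proof.
move=> rR sR rs [x sx rx] rp; apply/negP => wp.
have [q [rq _ /(_ x sx)]] := fork_covering_parent rR sR rs rp wp.
by rewrite rx.
Qed.

Lemma fork_level4_unlinked r s p1 p2 : r \in R -> s \in R -> linked r s ->
  lev w = 4 -> lev p1 = 3 -> lev p2 = 2 -> ~~ path e w [:: p1; p2; r].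
Proof.
move=> rR sR [b' [c [rb bc cs]]] w4 p1_3 p2_2; apply/negP => /and4P[wp1 p12 p2r _].
have sc : e s c by rewrite sym_e.
have b_lt := fork_root_nbr_lt rR rb; have c_lt := fork_root_nbr_lt sR sc.
have p1_lt : lev p1 < lev w by rewrite p1_3 w4.
have [p1b|p1b] := boolP (e p1 b').
  suff: e w c || e p1 s.
    have /andP[c_gt0 c_le] := level_root_nbr lf sR sc.
    by rewrite !(level_gap lf) ?w4 ?p1_3 ?(level_root lf sR).
  by apply: (fork_low_chord wp1 p1b bc cs) => //; apply: fork_root_lt.
suff: e w r || e p1 b' by rewrite (negbTE p1b) fork_root_nonadj.
apply: (fork_low_chord wp1 p12 p2r rb) => //; first by rewrite p2_2 w4.
exact: fork_root_lt.
Qed.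

Lemma fork_level3 : paired R -> lev w = 3.
Proof.
move=> pairR; have := fork_level_gt2; have := fork_level_le4.
rewrite leq_eqVlt => /orP[/eqP w4 _|w_lt4 w_gt2]; last first.
  by apply/eqP; rewrite eqn_leq w_gt2 andbT.
have [p1 wp1 lev_p1] := level_parent lf w4.
have [p2 p12 lev_p2] := level_parent lf lev_p1.
have [r p2r /(level1_root lf) rR] := level_parent lf lev_p2; have [s sR rs] := pairR r rR.
by have := fork_level4_unlinked rR sR rs w4 lev_p1 lev_p2; rewrite /= wp1 p12 p2r.
Qed.

Section LevelThree.

Hypothesis w3 : lev w = 3.

Lemma fork_parent : exists r p, [/\ r \in R, e r p & e w p].
Proof.
have [p wp lev_p] := level_parent lf w3; have [r pr lev_r] := level_parent lf lev_p.
by exists r, p; split=> //; [apply: level1_root lev_r | rewrite sym_e].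
Qed.

Lemma fork_remote r : r \in R -> remote r d.
Proof.
move=> rR; exists a; first exact: fork_da fk.
move=> p rp; have /andP[p_gt0 p_le] := level_root_nbr lf rR rp.
rewrite sym_e (level_gap lf) //; apply: leq_trans (fork_lev_a fk).
by rewrite w3 ltnS.
Qed.

Lemma fork_root_neq r : r \in R -> r != d.
Proof.
by move=> /(level_root lf) r1; apply: contra_eq_neq r1 => ->; rewrite (fork_lev_d fk) w3.
Qed.

End LevelThree.

End SingleFork.

(* A parent of the center of a fork over these four roots lies next to one of
   them.  Next to r1, r2 or r3 it would have to cover another root, which is
   remote; next to r4 it covers r2 and so extends to a path towards r1. *)
Lemma unambiguous4 r1 r2 r3 r4 :
    let R := [set r1; r2; r3; r4] in
    R \subset D -> r1 != r4 ->
    linked r1 r2 -> linked r1 r3 -> linked r2 r4 -> linked r3 r4 ->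
    remote r1 r3 -> remote r2 r4 -> remote r3 r4 ->
  unambiguous D R.
Proof.
move=> R RD r14 l12 l13 l24 l34 far13 far24 far34 lev w d a v b lf fk.
have r1R : r1 \in R by rewrite !inE eqxx.
have r2R : r2 \in R by rewrite !inE eqxx orbT.
have r3R : r3 \in R by rewrite !inE eqxx orbT.
have r4R : r4 \in R by rewrite !inE eqxx orbT.
have pairR : paired R.
  move=> r; rewrite !inE => /orP[/orP[/orP[]|]|] /eqP->.
  - by exists r2.
  - by exists r4.
  - by exists r4.
  by exists r2 => //; apply: linked_sym.
have w3 := fork_level3 lf RD fk pairR.
have away1 := fork_away lf RD fk r1R r3R l13 far13.
have away2 := fork_away lf RD fk r2R r4R l24 far24.
have away3 := fork_away lf RD fk r3R r4R l34 far34.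
have [r [p [rR rp wp]]] := fork_parent lf w3.
have {p rp wp rR r} [p r4p wp] : exists2 p, e r4 p & e w p.
  move: rR rp; rewrite !inE => /orP[/orP[/orP[]|]|] /eqP-> rp; last by exists p.
  - by rewrite away1 in wp.
  - by rewrite away2 in wp.
  by rewrite away3 in wp.
have [q [r4q wq q_r2]] := fork_covering_parent lf RD fk r4R r2R (linked_sym l24) r4p wp.
have [b' [c [r1b bc cr2]]] := l12; have r2c : e r2 c by rewrite sym_e.
have qr1 : e q r1 = false.
  by apply: (eds_nonadj edsD (a := r4)); rewrite ?(subsetP RD) // 1?eq_sym // sym_e.
suff: e w b' || e q r1 by rewrite away1 ?qr1.
apply: (fork_low_chord lf fk wq (q_r2 c r2c)); rewrite 1?sym_e //.
- exact: (fork_root_nbr_lt lf RD fk r4R).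
- exact: (fork_root_nbr_lt lf RD fk r2R).
- exact: (fork_root_nbr_lt lf RD fk r1R).
exact: (fork_root_lt lf RD fk).
Qed.

Section ThirdRoot.

Variables r1 r2 r3 b c x : T.
Let R := [set r1; r2; r3].
Hypotheses (RD : R \subset D) (r23 : r2 != r3).
Hypotheses (r1b : e r1 b) (bc : e b c) (cr2 : e c r2) (bx : e b x) (xr3 : e x r3).
Hypotheses (b_r2 : covers b r2) (far13 : remote r1 r3).

Lemma third_root_in : [/\ r1 \in R, r2 \in R & r3 \in R].
Proof. by rewrite !inE !eqxx !orbT. Qed.

Lemma third_root_linked : [/\ linked r1 r2, linked r1 r3 & paired R].
Proof.
have [l12 l13] : linked r1 r2 /\ linked r1 r3 by split; [exists b, c | exists b, x].
split=> // r; have [r1R r2R r3R] := third_root_in.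
rewrite inE => /orP[/set2P[]->|/set1P->]; first by exists r2.
  by exists r1 => //; apply: linked_sym.
by exists r1 => //; apply: linked_sym.
Qed.

Lemma third_fork_meets lev w d a v b' : level_function R lev ->
  fork D lev w d a v b' -> e w x /\ e w c.
Proof.
move=> lf fk; have [r1R r2R r3R] := third_root_in.
have [l12 l13 pairR] := third_root_linked; have w3 := fork_level3 lf RD fk pairR.
have rootD r : r \in R -> r \in D by apply: subsetP.
have r2c : e r2 c by rewrite sym_e.
have r3x : e r3 x by rewrite sym_e.
have root_lt := fork_root_lt lf RD fk; have nbr_lt := fork_root_nbr_lt lf RD fk.
have away1 := fork_away lf RD fk r1R r3R l13 far13.
have near3 q : e r3 q -> e w q -> e w c.
  move=> r3q wq.
  have [p [r3p wp /(_ b r1b) pb]] :=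
    fork_covering_parent lf RD fk r3R r1R (linked_sym l13) r3q wq.
  have pr2 : e p r2 = false.
    by apply: (eds_nonadj edsD (a := r3)); rewrite ?rootD // 1?eq_sym // sym_e.
  suff: e w c || e p r2 by rewrite pr2 orbF.
  by apply: (fork_low_chord lf fk wp pb bc cr2);
    [apply: (nbr_lt r3) | apply: (nbr_lt r1) | apply: (nbr_lt r2) | apply: root_lt].
have near2 q : e r2 q -> e w q -> e w x.
  move=> r2q wq; have qr3 : e q r3 = false.
    by apply: (eds_nonadj edsD (a := r2)); rewrite ?rootD // sym_e.
  suff: e w x || e q r3 by rewrite qr3 orbF.
  have qb : e q b by rewrite sym_e b_r2.
  by apply: (fork_low_chord lf fk wq qb bx xr3);
    [apply: (nbr_lt r2) | apply: (nbr_lt r1) | apply: (nbr_lt r3) | apply: root_lt].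
have [r [q [rR rq wq]]] := fork_parent lf w3.
move: rR rq; rewrite inE => /orP[/set2P[]->|/set1P->] rq.
- by rewrite away1 in wq.
- have wx := near2 q rq wq; split=> //; exact: near3 r3x wx.
have wc := near3 q rq wq; split=> //; exact: near2 r2c wc.
Qed.

Lemma unambiguous_third : exists r4, let R4 := [set r1; r2; r3; r4] in
  R4 \subset D /\ unambiguous D R4.
Proof.
have [unamb|/ambiguousP] := classic (unambiguous D R).
  by exists r3; rewrite /= -setUA setUid.
move=> [lev [w [r4 [a [v [b' [lf fk]]]]]]]; have [wx wc] := third_fork_meets lf fk.
have [r1R r2R r3R] := third_root_in; have [l12 l13 pairR] := third_root_linked.
have w3 := fork_level3 lf RD fk pairR; have wr4 := fork_wd fk.
have RD4 : [set r1; r2; r3; r4] \subset D by rewrite subUset RD sub1set (fork_dominator fk).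
exists r4; split=> //; apply: unambiguous4 => //.
- exact: fork_root_neq lf fk w3 _ r1R.
- by exists c, w; split; rewrite // sym_e.
- by exists x, w; split; rewrite // sym_e.
- exact: fork_remote lf fk w3 _ r2R.
exact: fork_remote lf fk w3 _ r3R.
Qed.

End ThirdRoot.

Lemma unambiguous_second r1 r2 lev w d a v b p :
    let R := [set r1; r2] in R \subset D -> linked r1 r2 ->
    level_function R lev -> fork D lev w d a v b -> e r1 p -> e w p ->
  exists r3 r4, let R4 := [set r1; r2; r3; r4] in
  R4 \subset D /\ unambiguous D R4.
Proof.
move=> R RD l12 lf fk r1p wp.
have r1R : r1 \in R by rewrite !inE eqxx.
have r2R : r2 \in R by rewrite !inE eqxx orbT.
have pairR : paired R.
  move=> s /set2P[]->; first by exists r2.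
  by exists r1 => //; apply: linked_sym.
have w3 := fork_level3 lf RD fk pairR.
have [q [r1q wq q_r2]] := fork_covering_parent lf RD fk r1R r2R l12 r1p wp.
have [_ [c [_ _ cr2]]] := l12.
exists d; apply: (unambiguous_third (b := q) (c := c) (x := w)) => //.
- by rewrite subUset RD sub1set (fork_dominator fk).
- exact: fork_root_neq lf fk w3 _ r2R.
- by apply: q_r2; rewrite sym_e.
- by rewrite sym_e.
- exact: fork_wd fk.
exact: fork_remote lf fk w3 _ r1R.
Qed.

Lemma exists_unambiguous x : exists r1 r2 r3 r4, let R := [set r1; r2; r3; r4] in
  [/\ R \subset D, connect e r1 x & unambiguous D R].
Proof.
have csym := sym_connect_sym sym_e; have [r0 r0D xr0] := eds_dominator edsD x.
have r0x : connect e r0 x.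
  by move: xr0; rewrite inE csym => /orP[/eqP->|/connect1].
have [unamb|/ambiguousP] := classic (unambiguous D [set r0]).
  by exists r0, r0, r0, r0; rewrite /= !setUid sub1set.
move=> [lev [w [r1 [a [c [r2 [lf fk]]]]]]].
have wx : connect e w x.
  have [_ /set1P-> r0w] := connect_root_level lf (fork_reached fk).
  by apply: connect_trans r0x; rewrite csym.
have [wr1 wc cr2] := And3 (fork_wd fk) (fork_wv fk) (fork_vb fk).
have r1x : connect e r1 x by apply: connect_trans wx; rewrite csym connect1.
have r2x : connect e r2 x.
  apply: connect_trans wx; rewrite csym.
  exact: connect_trans (connect1 wc) (connect1 cr2).
have RD : [set r1; r2] \subset D.
  by rewrite subUset !sub1set (fork_dominator fk) (fork_rival_dominator fk).
have l12 : linked r1 r2 by exists w, c; split; rewrite // sym_e.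
have [unamb|/ambiguousP] := classic (unambiguous D [set r1; r2]).
  by exists r1, r2, r2, r2; rewrite /= -!setUA !setUid.
move=> [lev' [w' [d [a' [v [b [lf' fk']]]]]]].
have pairR : paired [set r1; r2].
  move=> s /set2P[]->; first by exists r2; rewrite ?set22.
  by exists r1; rewrite ?set21 //; apply: linked_sym.
have w3 := fork_level3 lf' RD fk' pairR.
have [r [p [/set2P[]-> rp w'p]]] := fork_parent lf' w3.
  have [r3 [r4 [R4D unamb]]] := unambiguous_second RD l12 lf' fk' rp w'p.
  by exists r1, r2, r3, r4.
rewrite setUC in RD lf'.
have [r3 [r4 [R4D unamb]]] := unambiguous_second RD (linked_sym l12) lf' fk' rp w'p.
by exists r2, r1, r3, r4.
Qed.

End Forks.

End Levels.

(** * Greedy reconstruction *)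

Section Greedy.

Variables (T : finType) (e : rel T).
Hypothesis irr_e : irreflexive e.

Definition candidate (P : {set T}) (lev : T -> nat) (w v : T) : bool :=
  [&& e w v, dominators e P v == 0 & lev v == (lev w).+1].

Definition outer_nbrs (lev : T -> nat) (v : T) : {set T} :=
  [set t | e v t && (lev v <= lev t)].

Definition recoverable (D R : {set T}) : Prop :=
  [/\ efficient_dominating_set e D, R \subset D & unambiguous e D R].

Record partial_recovery (D R P : {set T}) (s : seq T) : Prop := PartialRecovery {
  recovery_roots : R \subset P;
  recovery_sub : P \subset D;
  recovery_dominated : forall t, t \in s -> 0 < dominators e P t
}.

Section Step.

Variables (D R P : {set T}) (lev : T -> nat) (s : seq T) (w : T).
Hypotheses (recD : recoverable D R) (recP : partial_recovery D R P s).
Hypotheses (lf : level_function e R lev) (w_gt0 : 0 < lev w).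
Hypothesis s_below : forall t, 0 < lev t < lev w -> t \in s.

Lemma partial_recovery_rcons :
  0 < dominators e P w -> partial_recovery D R P (rcons s w).
Proof.
case: recP => RP PD dom_s dom_w; split=> // t.
by rewrite mem_rcons inE => /orP[/eqP->|/dom_s].
Qed.

Hypothesis undom_w : dominators e P w = 0.

Lemma low_dominator_chosen d : d \in D -> 0 < lev d <= lev w -> d \in P.
Proof.
case: recD recP => edsD _ _ [RP PD dom_s] dD /andP[d_gt0 d_le].
have [root _ parent] := lf; case: (ltnP 1 (lev d)) => d_lev; last first.
  by apply: (subsetP RP); rewrite -root eqn_leq d_lev.
have [p pd p_lev] := parent d d_lev.
have p_below : 0 < lev p < lev w by rewrite p_lev d_le -ltnS p_lev d_lev.
have /dominators_gt0P[d' d'P pd'] := dom_s p (s_below p_below).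
by rewrite (eds_uniq edsD dD (subsetP PD _ d'P) (closed_nbhd_adj pd) pd').
Qed.

Lemma eds_dominator_candidate d : d \in D -> d \in closed_nbhd e w ->
  candidate P lev w d.
Proof.
case: recD recP => edsD _ _ [RP PD _] dD wd.
have dP : d \notin P by apply: dominators_eq0 undom_w wd.
have wd_adj : e w d.
  move: wd; rewrite inE => /orP[/eqP dw|//]; case/negP: dP.
  by apply: low_dominator_chosen; rewrite // dw w_gt0 leqnn.
have [_ step _] := lf; have /andP[d_gt0 d_le] := step _ _ wd_adj w_gt0.
rewrite /candidate wd_adj [lev d == _]eqn_leq d_le ltnNge /=; apply/andP; split.
  rewrite -leqn0 leqNgt; apply/negP => /dominators_gt0P[d' d'P dd'].
  case/negP: dP; rewrite (eds_uniq edsD dD (subsetP PD _ d'P) _ dd') //.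
  exact: closed_nbhd_refl.
by apply: contra dP => d_low; apply: low_dominator_chosen; rewrite ?d_gt0.
Qed.

Lemma exists_candidate : exists v, candidate P lev w v.
Proof.
case: (recD) => edsD _ _; have [d dD wd] := eds_dominator edsD w.
by exists d; apply: eds_dominator_candidate.
Qed.

(* Otherwise [v], whose dominator lies further out and is not adjacent to [d],
   would leave [d] a private outer neighbour and so complete a fork. *)
Lemma rival_outer_nbrs_gt d v :
    d \in D -> candidate P lev w d -> candidate P lev w v -> v != d ->
  #|outer_nbrs lev d| < #|outer_nbrs lev v|.
Proof.
case: recD => edsD _ unamb dD /and3P[wd _ /eqP d_lev] /and3P[wv /eqP undom_v /eqP v_lev] vd.
have [_ step _] := lf; have [b bD vb] := eds_dominator edsD v.
have bP := dominators_eq0 undom_v vb.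
have {}vb : e v b.
  move: vb; rewrite inE => /orP[/eqP bv|//]; case/eqP: vd; rewrite -bv.
  by apply: (eds_uniq edsD bD dD (t := w)); rewrite ?bv closed_nbhd_adj.
have /andP[b_gt0 _] : 0 < lev b <= (lev v).+1 by apply: step; rewrite ?v_lev.
have b_outer : lev w < lev b.
  by rewrite ltnNge; apply: contra bP => le; apply: low_dominator_chosen; rewrite ?b_gt0.
have db : e d b = false := eds_indep irr_e edsD dD bD.
rewrite ltnNge; apply/negP => le.
have /subsetPn[a] : ~~ (outer_nbrs lev d \subset outer_nbrs lev v).
  apply/negP => sub; have /eqP/setP/(_ b) : outer_nbrs lev d == outer_nbrs lev v.
    by rewrite eqEcard sub.
  by rewrite !inE db vb v_lev b_outer.
rewrite !inE d_lev v_lev => /andP[da a_outer]; rewrite a_outer andbT => /negbTE va.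
by apply: (unamb lev w d a v b lf); split.
Qed.

Lemma min_candidate_in_eds v : candidate P lev w v ->
    (forall v', candidate P lev w v' -> #|outer_nbrs lev v| <= #|outer_nbrs lev v'|) ->
  v \in D.
Proof.
case: (recD) => edsD _ _ cand_v min_v; have [d dD wd] := eds_dominator edsD w.
have cand_d := eds_dominator_candidate dD wd.
have [-> //|vd] := eqVneq v d.
by have := rival_outer_nbrs_gt dD cand_d cand_v vd; rewrite ltnNge min_v.
Qed.

Lemma partial_recovery_add v : candidate P lev w v ->
    (forall v', candidate P lev w v' -> #|outer_nbrs lev v| <= #|outer_nbrs lev v'|) ->
  partial_recovery D R (v |: P) (rcons s w).
Proof.
move=> cand_v min_v; have vD := min_candidate_in_eds cand_v min_v.
case: recP => RP PD dom_s; have PvP : P \subset v |: P by apply: subsetUr.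
split=> [||t]; first exact: subset_trans PvP.
  by rewrite subUset sub1set vD.
rewrite mem_rcons inE => /orP[/eqP->|/dom_s dom_t].
  apply/dominators_gt0P; exists v; rewrite ?setU11 // closed_nbhd_adj //.
  by case/and3P: cand_v.
by apply: leq_trans dom_t _; apply: dominators_sub.
Qed.

End Step.

End Greedy.

(** * Breadth-first search *)

Section BreadthFirstSearch.

Variables (T : finType) (e : rel T) (R : {set T}).

Record bfs_inv (done todo : seq T) (lev : T -> nat) : Prop := BfsInv {
  bfs_uniq : uniq (done ++ todo);
  bfs_reached : forall v, (0 < lev v) = (v \in done ++ todo);
  bfs_root : forall v, (lev v == 1) = (v \in R);
  bfs_parent : forall v, 1 < lev v -> exists2 u, e u v & (lev u).+1 = lev v;
  bfs_sorted : pairwise (relpre lev leq) (done ++ todo);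
  bfs_front : forall u v, u \in todo -> lev v <= (lev u).+1;
  bfs_scanned : forall u v, u \in done -> e u v -> 0 < lev v <= (lev u).+1
}.

Lemma bfs_init q (lev : T -> nat) : uniq q -> q =i R -> (forall v, lev v = (v \in R)) ->
  bfs_inv [::] q lev.
Proof.
move=> uniq_q qR levE; split=> //= [v|v|v||u v _].
- by rewrite levE qR lt0b.
- by rewrite levE eqb1.
- by rewrite levE; case: (v \in R).
- have : all [pred v | lev v == 1] q by apply/allP => v /=; rewrite levE -qR => ->.
  elim: (q) => //= u q' IHq /andP[/eqP u1 q'1]; rewrite IHq // andbT.
  by apply: sub_all q'1 => v /= /eqP->; rewrite u1.
by rewrite levE (leq_trans (leq_b1 _)).
Qed.

Lemma bfs_push done u todo lev v lev' :
    bfs_inv done (u :: todo) lev -> e u v -> lev v = 0 ->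
    (forall t, lev' t = if t == v then (lev u).+1 else lev t) ->
  bfs_inv done (u :: rcons todo v) lev'.
Proof.
move=> [uq reached root parent srt front scanned] uv v0 lev'E.
set q := done ++ u :: todo in uq reached srt.
have qv : done ++ u :: rcons todo v = rcons q v by rewrite -rcons_cons -rcons_cat.
have v_notin : v \notin q by rewrite -reached v0.
have old t : t \in q -> lev' t = lev t.
  by rewrite lev'E; case: eqP => // ->; rewrite (negbTE v_notin).
have u_q : u \in q by rewrite mem_cat mem_head orbT.
have u_gt0 : 0 < lev u by rewrite reached.
have u_le t : t \in u :: todo -> lev u <= lev t.
  rewrite inE => /orP[/eqP->//|t_todo].
  by move: srt; rewrite pairwise_cat => /and3P[_ _ /andP[/allP/(_ t t_todo)]].
split; rewrite ?qv.
- by rewrite rcons_uniq v_notin.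
- by move=> t; rewrite lev'E mem_rcons inE -reached; case: eqP.
- move=> t; rewrite lev'E; case: (t =P v) => [->|_]; last exact: root.
  by rewrite -root v0 eqSS; case: (lev u) u_gt0.
- move=> t; rewrite lev'E; case: (t =P v) => [-> _|_ t_gt1].
    by exists u; rewrite ?old.
  have [p pt lev_p] := parent t t_gt1.
  by exists p; rewrite ?old // -reached -ltnS lev_p.
- rewrite pairwise_rcons; apply/andP; split.
    apply/allP => t t_q /=; rewrite (lev'E v) eqxx old //.
    by apply: front; rewrite mem_head.
  rewrite (eq_in_pairwise (P := [in q]) (r' := relpre lev leq)) //.
  by move=> s t sq tq /=; rewrite !old.
- move=> s t; rewrite -rcons_cons mem_rcons inE => s_mem.
  have lev's : lev u <= lev' s.
    rewrite lev'E; case: eqP s_mem => //= _; exact: u_le.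
  rewrite lev'E; case: eqP => // _; apply: leq_trans (front u t _) _ => //.
  exact: mem_head.
move=> s t s_done st; have /andP[t_gt0 t_le] := scanned s t s_done st.
have s_q : s \in q by rewrite mem_cat s_done.
by rewrite !old ?t_gt0 // -reached.
Qed.

Lemma bfs_next done u todo lev : bfs_inv done (u :: todo) lev ->
  (forall v, e u v -> 0 < lev v) -> bfs_inv (rcons done u) todo lev.
Proof.
move=> [uq reached root parent srt front scanned] nbr; split=> //; rewrite ?cat_rcons //.
  by move=> t v t_todo; apply: front; rewrite inE t_todo orbT.
move=> t v; rewrite mem_rcons inE => /orP[/eqP->|t_done] tv; last exact: scanned.
by rewrite nbr // front ?mem_head.
Qed.

Lemma bfs_level q lev : bfs_inv q [::] lev -> level_function e R lev.
Proof.
case; rewrite cats0 => _ reached root parent _ _ scanned; split=> // u v uv.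
by rewrite reached => /scanned; apply.
Qed.

Lemma bfs_before q s1 u s2 lev t : bfs_inv q [::] lev -> q = s1 ++ u :: s2 ->
  0 < lev t < lev u -> t \in s1.
Proof.
case; rewrite cats0 => _ reached _ _ srt _ _ q_split /andP[].
rewrite reached q_split mem_cat inE => /or3P[//|/eqP->|t_s2]; first by rewrite ltnn.
move: srt; rewrite q_split pairwise_cat => /and3P[_ _ /andP[/allP/(_ t t_s2) /= ut _]].
by rewrite ltnNge ut.
Qed.

End BreadthFirstSearch.

(** * Arrays and frames *)

Definition arr (s : state) (j i : nat) : nat :=
  mem s (regs s 0 * regs s 0 + 8 * i + j).

Definition put (s : state) (j i v : nat) : state :=
  set_mem s (regs s 0 * regs s 0 + 8 * i + j) v.

Arguments arr : simpl never.
Arguments put : simpl never.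

Lemma arr_put s j i v j' i' : j < 8 -> j' < 8 ->
  arr (put s j i v) j' i' = if (j' == j) && (i' == i) then v else arr s j' i'.
Proof.
move=> j8 j8'; rewrite /arr /= /update; congr (if _ then _ else _).
by apply/eqP/andP => [h|[/eqP-> /eqP->]] //; split; apply/eqP; lia.
Qed.

Lemma arr_set_reg s x v j i : x != 0 -> arr (set_reg s x v) j i = arr s j i.
Proof. by move=> x0; rewrite /arr /= /update eq_sym (negbTE x0). Qed.

Lemma sem_PSkip s : sem PSkip s = s.
Proof. by []. Qed.

Lemma sem_PSet x E s : sem (PSet x E) s = set_reg s x (ev s E).
Proof. by []. Qed.

Lemma sem_PPut j X E s : sem (PPut j X E) s = put s j (ev s X) (ev s E).
Proof. by []. Qed.

Lemma sem_PSeq p q s : sem (PSeq p q) s = sem q (sem p s).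
Proof. by []. Qed.

Lemma sem_PIf E p q s :
  sem (PIf E p q) s = if ev s E != 0 then sem p s else sem q s.
Proof. by []. Qed.

Record frame (p : prog) (s s' : state) : Prop := Frame {
  frame_reg : forall x, ~~ assigns x p -> regs s' x = regs s x;
  frame_arr : forall j i, j < 8 -> ~~ writes j p -> arr s' j i = arr s j i;
  frame_low : forall a, a < regs s 0 * regs s 0 -> mem s' a = mem s a
}.

Lemma frame_refl p s : frame p s s.
Proof. by []. Qed.

Lemma frame_sub p q s s' :
    (forall x, assigns x q -> assigns x p) -> (forall j, writes j q -> writes j p) ->
  frame q s s' -> frame p s s'.
Proof.
move=> sub_x sub_j [fr fa fl]; split=> // [x|j i j8] /negP px; [apply: fr|apply: fa] => //.
  by apply/negP => /sub_x.
by apply/negP => /sub_j.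
Qed.

Lemma frame_trans p s s1 s2 : wf p -> frame p s s1 -> frame p s1 s2 -> frame p s s2.
Proof.
move=> wp [fr1 fa1 fl1] [fr2 fa2 fl2].
have r0 : regs s1 0 = regs s 0 by apply/fr1/wf_assigns0.
split=> [x px|j i j8 pj|a a_lt].
- by rewrite fr2 ?fr1.
- by rewrite fa2 ?fa1.
- by rewrite fl2 ?r0 ?fl1.
Qed.

Lemma frame_set_reg p s s' x v : x != 0 -> assigns x p ->
  frame p s s' -> frame p s (set_reg s' x v).
Proof.
move=> x0 px [fr fa fl]; split=> // [y py|j i j8 pj].
  by rewrite /= /update; case: eqP => [yx|_]; [rewrite yx px in py | apply: fr].
by rewrite arr_set_reg // fa.
Qed.

Lemma sem_frame p s : wf p -> frame p s (sem p s).
Proof.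
elim: p s => [|x E|j X E|p IHp q IHq|E p IHp q IHq|x p IHp] s wfp.
- exact: frame_refl.
- case/and3P: (wfp) => x0 _ _.
  by apply: frame_set_reg (frame_refl _ _); rewrite /= ?eqxx.
- case/and4P: wfp => j8 _ _ _; rewrite sem_PPut.
  split=> // [k i k8 /= /negbTE kj|a a_lt]; first by rewrite arr_put // kj.
  by rewrite /= /update; case: eqP => // a_eq; lia.
- case/andP: (wfp) => wp wq.
  apply: frame_trans (frame_sub _ _ (IHp s wp)) (frame_sub _ _ (IHq _ wq)) => // k /= ->;
    by rewrite ?orbT.
- case/and3P: (wfp) => _ wp wq /=; case: ifP => _.
    by apply: frame_sub (IHp s wp) => k /= ->.
  by apply: frame_sub (IHq s wq) => k /= ->; rewrite orbT.
case/and3P: (wfp) => x0 xp wp /=.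
have ass_x : assigns x (PFor x p) by rewrite /= eqxx.
elim: (regs s 0) => [|k IHk] /=; first exact: frame_set_reg (frame_refl _ _).
apply: frame_set_reg => //; apply: frame_trans IHk (frame_sub _ _ (IHp _ wp)) => //.
by move=> y /= ->; rewrite orbT.
Qed.

(** * Verified loops *)

Definition And (E F : expr) : expr := Op OpLt (Const 0) (Op OpMul E F).
Definition Or (E F : expr) : expr := Op OpLt (Const 0) (Op OpAdd E F).
Definition Not (E : expr) : expr := Op OpEq E (Const 0).

Lemma neq0b (b : bool) : (b != 0 :> nat) = b.
Proof. by case: b. Qed.

Lemma ev_And s E F : ev s (And E F) = (ev s E != 0) && (ev s F != 0).
Proof. by rewrite /= muln_gt0 !lt0n. Qed.

Lemma ev_Or s E F : ev s (Or E F) = (ev s E != 0) || (ev s F != 0).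
Proof. by rewrite /= addn_gt0 !lt0n. Qed.

Lemma ev_Not s E : ev s (Not E) = (ev s E == 0).
Proof. by []. Qed.

Lemma ev_Eq s E F : ev s (Op OpEq E F) = (ev s E == ev s F).
Proof. by []. Qed.

Lemma ev_Lt s E F : ev s (Op OpLt E F) = (ev s E < ev s F).
Proof. by []. Qed.

Lemma ev_Add s E F : ev s (Op OpAdd E F) = ev s E + ev s F.
Proof. by []. Qed.

Lemma ev_Const s v : ev s (Const v) = v.
Proof. by []. Qed.

Lemma ev_Reg s x : ev s (Reg x) = regs s x.
Proof. by []. Qed.

Lemma ev_Cell s j X : ev s (Cell j X) = arr s j (ev s X).
Proof. by []. Qed.

Definition evE := (ev_And, ev_Or, ev_Not, ev_Eq, ev_Lt, ev_Add, ev_Const, ev_Reg, ev_Cell).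

Definition tabulate (x j : nat) (p : prog) (E : expr) : prog :=
  PFor x (PSeq p (PPut j (Reg x) E)).

Definition count_if (x y : nat) (E : expr) : prog :=
  PSeq (PSet y (Const 0)) (PFor x (PSet y (Op OpAdd (Reg y) E))).

Definition check_all (x y : nat) (E : expr) : prog :=
  PSeq (PSet y (Const 1)) (PFor x (PIf E PSkip (PSet y (Const 0)))).

(* The result is n if no index satisfies [E]. *)
Definition argmin (x y j : nat) (E : expr) : prog :=
  let better := Op OpLt (Cell j (Reg x)) (Cell j (Reg y)) in
  PSeq (PSet y (Reg 0))
    (PFor x (PIf (And E (Or (Op OpEq (Reg y) (Reg 0)) better)) (PSet y (Reg x)) PSkip)).

Section Loops.

Variable n : nat.

Lemma ltS_ord (t i : 'I_n) : (t < i.+1) = (t == i) || (t < i).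
Proof. by rewrite ltnS leq_eqVlt. Qed.

Lemma sem_for (Inv : nat -> state -> Prop) x p s :
    wf (PFor x p) -> regs s 0 = n ->
    (forall k s' v, Inv k s' -> Inv k (set_reg s' x v)) ->
    Inv 0 s ->
    (forall (i : 'I_n) s', frame (PFor x p) s s' -> regs s' x = i -> Inv i s' ->
      Inv i.+1 (sem p s')) ->
  Inv n (sem (PFor x p) s).
Proof.
move=> wfx s0 stable inv0 invS; case/and3P: (wfx) => x0 xp wp.
have ass_x : assigns x (PFor x p) by rewrite /= eqxx.
rewrite /= s0; set step := fun s' => _.
suff H k : k <= n -> let s' := iter k step (set_reg s x 0) in
    [/\ frame (PFor x p) s s', regs s' x = k & Inv k s'].
  by case: (H n (leqnn n)).
elim: k => [_|k IHk lt] /=.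
  split; last exact: stable.
    exact: frame_set_reg (frame_refl _ _).
  by rewrite /update eqxx.
case: (IHk (ltnW lt)); set s' := iter _ _ _ => fr rx inv.
have rx' : regs (sem p s') x = k by rewrite sem_reg_unassigned.
rewrite /step rx' addn1; split; last by apply/stable/(invS (Ordinal lt)).
  apply: frame_set_reg => //; apply: frame_trans fr (frame_sub _ _ (sem_frame _ wp)) => //.
  by move=> y /= ->; rewrite orbT.
by rewrite /= /update eqxx.
Qed.

Lemma sem_init_for (Inv : nat -> state -> Prop) x y E p s :
    let q := PSeq (PSet y E) (PFor x p) in
    wf q -> regs s 0 = n ->
    (forall k s' v, Inv k s' -> Inv k (set_reg s' x v)) ->
    Inv 0 (set_reg s y (ev s E)) ->
    (forall (i : 'I_n) s', frame q s s' -> regs s' x = i -> Inv i s' ->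
      Inv i.+1 (sem p s')) ->
  Inv n (sem q s).
Proof.
move=> q wfq s0 stable inv0 invS; have [wf_init wf_for] := andP wfq.
have fr_init : frame q s (set_reg s y (ev s E)).
  by apply: (frame_sub _ _ (sem_frame (p := PSet y E) s wf_init)) => //= k ->.
apply: sem_for => // [|i s' fr]; first by rewrite (frame_reg fr_init) ?wf_assigns0.
apply: invS; apply: frame_trans fr_init _ => //.
by apply: (frame_sub _ _ fr) => //= k ->; rewrite orbT.
Qed.

Lemma forall_ltS (c : pred 'I_n) (i : 'I_n) :
  [forall t : 'I_n, (t < i.+1) ==> c t] = c i && [forall t : 'I_n, (t < i) ==> c t].
Proof.
apply/forall_inP/andP => [all_c|[ci /forall_inP all_c] t].
  split; first by apply: all_c.
  by apply/forall_inP => t ti; apply/all_c/ltnW.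
by rewrite ltS_ord => /orP[/eqP->|/all_c].
Qed.

Lemma card_ltS (c : pred 'I_n) (i : 'I_n) :
  #|[pred t | c t & t < i.+1]| = #|[pred t : 'I_n | c t & t < i]| + c i.
Proof.
rewrite (cardD1 i) inE ltnSn andbT addnC; congr (_ + _); apply: eq_card => t.
by rewrite !inE ltS_ord; case: eqP => [->|_] //; rewrite ltnn andbF.
Qed.

Lemma tabulateP x j p E s (f : 'I_n -> nat) :
    wf (tabulate x j p E) -> ~~ writes j p -> regs s 0 = n ->
    (forall (i : 'I_n) s', frame (tabulate x j p E) s s' -> regs s' x = i ->
       arr s' j i = arr s j i -> ev (sem p s') E = f i) ->
  forall i : 'I_n, arr (sem (tabulate x j p E) s) j i = f i.
Proof.
move=> wfT jp s0 valE i; case/and3P: (wfT) => x0 /norP[xp _] /andP[wp /andP[j8 _]].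
pose Inv k s' := forall t : 'I_n, arr s' j t = if t < k then f t else arr s j t.
suff : Inv n (sem (tabulate x j p E) s) by move=> ->; rewrite ltn_ord.
apply: sem_for => // [k s' v inv t|{}i s' fr s'x inv t]; first by rewrite arr_set_reg.
rewrite sem_PSeq sem_PPut arr_put // eqxx (valE i) //; last by rewrite inv ltnn.
rewrite ev_Reg sem_reg_unassigned // s'x ltS_ord val_eqE (frame_arr (sem_frame s' wp)) //.
by case: eqP => [->|_] //; apply: inv.
Qed.

Lemma count_ifP x y E s (c : pred 'I_n) :
    wf (count_if x y E) -> regs s 0 = n ->
    (forall (i : 'I_n) s', frame (count_if x y E) s s' -> regs s' x = i ->
       ev s' E = c i) ->
  regs (sem (count_if x y E) s) y = #|c|.
Proof.
move=> wfC s0 testE; have /and3P[_ _ /andP[/= /negbTE xy _]] := wfC.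
pose Inv k s' := regs s' y = #|[pred t : 'I_n | c t & t < k]|.
suff -> : Inv n (sem (count_if x y E) s).
  by apply: eq_card => t; rewrite !inE ltn_ord andbT.
apply: sem_init_for => // [k s' v inv||i s' fr s'x inv]; rewrite /Inv /= /update.
- by rewrite [y == x]eq_sym xy.
- by rewrite eqxx; apply/esym/eq_card0 => t; rewrite !inE andbF.
by rewrite eqxx (testE i) // inv card_ltS.
Qed.

Lemma check_allP x y E s (c : pred 'I_n) :
    wf (check_all x y E) -> regs s 0 = n ->
    (forall (i : 'I_n) s', frame (check_all x y E) s s' -> regs s' x = i ->
       (ev s' E != 0) = c i) ->
  (regs (sem (check_all x y E) s) y != 0) = [forall i, c i].
Proof.
move=> wfC s0 testE; have /and3P[_ _ /andP[/= /negbTE xy _]] := wfC.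
pose Inv k s' := (regs s' y != 0) = [forall t : 'I_n, (t < k) ==> c t].
suff -> : Inv n (sem (check_all x y E) s) by apply: eq_forallb => t; rewrite ltn_ord.
apply: sem_init_for => // [k s' v inv||i s' fr s'x inv]; rewrite /Inv.
- by rewrite /= /update [y == x]eq_sym xy.
- by rewrite /= /update eqxx; apply/esym/forallP.
rewrite forall_ltS -inv sem_PIf (testE i) //; case: (c i) => //.
by rewrite /= /update eqxx.
Qed.

Lemma argminP x y j E s (c : pred 'I_n) :
    wf (argmin x y j E) -> j < 8 -> regs s 0 = n ->
    (forall (i : 'I_n) s', frame (argmin x y j E) s s' -> regs s' x = i ->
       (ev s' E != 0) = c i) ->
  let b := regs (sem (argmin x y j E) s) y in
  (b = n /\ forall i, ~~ c i) \/
  exists i : 'I_n, [/\ b = i, c i & forall t : 'I_n, c t -> arr s j i <= arr s j t].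
Proof.
move=> wfA j8 s0 testE /=; have /and3P[_ _ /andP[/= /norP[/negbTE xy _] _]] := wfA.
pose Inv k s' := (regs s' y = n /\ forall i : 'I_n, i < k -> ~~ c i) \/
  exists i : 'I_n, [/\ regs s' y = i, c i
    & forall t : 'I_n, t < k -> c t -> arr s j i <= arr s j t].
suff [[b_n none]|[i [b_i ci min_i]]] : Inv n (sem (argmin x y j E) s).
- by left; split=> // i; apply: none.
- by right; exists i; split=> // t; apply: min_i.
apply: sem_init_for => // [k s' v||i s' fr s'x inv]; rewrite /Inv.
- by rewrite /= /update [y == x]eq_sym xy.
- by left; rewrite /= /update eqxx s0.
have s'0 : regs s' 0 = n by rewrite (frame_reg fr) // wf_assigns0.
have arrE t : arr s' j t = arr s j t by rewrite (frame_arr fr).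
rewrite sem_PIf !evE !neq0b (testE i) // s'x s'0 !arrE.
have [ci|nci] /= := boolP (c i); last first.
  case: inv => [[b_n none]|[b [s'y cb min_b]]]; [left|right; exists b]; split=> // t;
    rewrite ltS_ord => /orP[/eqP-> //|]; first exact: none.
    by rewrite (negbTE nci).
  exact: min_b.
have take_i : (forall t : 'I_n, t < i -> c t -> arr s j i <= arr s j t) ->
    Inv i.+1 (set_reg s' y (regs s' x)).
  move=> min_i; right; exists i; rewrite /= /update eqxx s'x; split=> // t.
  by rewrite ltS_ord => /orP[/eqP->|/min_i].
case: inv => [[b_n none]|[b [s'y cb min_b]]].
  by rewrite b_n eqxx; apply: take_i => t /none/negbTE->.
rewrite s'y (ltn_eqF (ltn_ord b)) /=; case: ltnP => ib.
  by apply: take_i => t ti ct; apply: leq_trans (ltnW ib) (min_b t ti ct).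
right; exists b; split=> // t.
by rewrite ltS_ord => /orP[/eqP->|/min_b].
Qed.

End Loops.

(** * The algorithm *)

(* Register numbers; register 0 holds n throughout. *)
Definition guess1 : nat := 1.
Definition guess2 : nat := 2.
Definition guess3 : nat := 3.
Definition guess4 : nat := 4.
Definition outer_index : nat := 5.
Definition inner_index : nat := 6.
Definition queue_size : nat := 7.
Definition current : nat := 8.
Definition chosen : nat := 9.
Definition verdict : nat := 10.
Definition tally : nat := 11.

Definition level_arr : nat := 0.
Definition queue_arr : nat := 1.
Definition outer_degree_arr : nat := 2.
Definition dominators_arr : nat := 3.
Definition settled_arr : nat := 4.

Definition Adj (x y : nat) : expr := Read (Op OpAdd (Op OpMul (Reg x) (Reg 0)) (Reg y)).
Definition InNbhd (x y : nat) : expr := Or (Op OpEq (Reg x) (Reg y)) (Adj y x).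
Definition Level (x : nat) : expr := Cell level_arr (Reg x).
Definition Dominators (x : nat) : expr := Cell dominators_arr (Reg x).
Definition Settled (x : nat) : expr := Cell settled_arr (Reg x).

Definition IsGuess (x : nat) : expr := Op OpEq (Reg outer_index) (Reg x).

Definition set_root_levels : prog :=
  tabulate outer_index level_arr PSkip
    (Or (Or (Or (IsGuess guess1) (IsGuess guess2)) (IsGuess guess3)) (IsGuess guess4)).

Definition count_root_dominators : prog :=
  tabulate outer_index dominators_arr
    (count_if inner_index tally (And (Level inner_index) (InNbhd inner_index outer_index)))
    (Reg tally).

Definition enqueue (x : nat) : prog :=
  PSeq (PPut queue_arr (Reg queue_size) (Reg x)) (PSet queue_size (succ_reg queue_size)).

Definition enqueue_roots : prog :=
  PSeq (PSet queue_size (Const 0))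
    (PFor outer_index (PIf (Level outer_index) (enqueue outer_index) PSkip)).

Definition for_queue (p : prog) : prog :=
  PFor outer_index (PIf (Op OpLt (Reg outer_index) (Reg queue_size))
    (PSeq (PSet current (Cell queue_arr (Reg outer_index))) p) PSkip).

Definition scan_nbrs : prog :=
  PFor inner_index (PIf (And (Adj current inner_index) (Not (Level inner_index)))
    (PSeq (PPut level_arr (Reg inner_index) (Op OpAdd (Level current) (Const 1)))
      (enqueue inner_index)) PSkip).

Definition count_outer_nbrs : prog :=
  tabulate outer_index outer_degree_arr
    (count_if inner_index tally (And (Adj outer_index inner_index)
      (Not (Op OpLt (Level inner_index) (Level outer_index)))))
    (Reg tally).

Definition add_dominator : prog :=
  tabulate inner_index dominators_arr PSkip
    (Op OpAdd (Dominators inner_index) (InNbhd inner_index chosen)).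

Definition choose_candidate : prog :=
  argmin inner_index chosen outer_degree_arr
    (And (And (Adj current inner_index) (Not (Dominators inner_index)))
      (Op OpEq (Level inner_index) (Op OpAdd (Level current) (Const 1)))).

Definition greedy_step : prog :=
  PIf (Dominators current) PSkip
    (PSeq choose_candidate (PIf (Op OpLt (Reg chosen) (Reg 0)) add_dominator PSkip)).

Definition verify : prog :=
  check_all outer_index verdict
    (Or (Not (Level outer_index)) (Op OpEq (Dominators outer_index) (Const 1))).

Definition settle : prog :=
  tabulate outer_index settled_arr PSkip
    (Or (Settled outer_index) (And (Reg verdict) (Level outer_index))).

Definition init : prog :=
  PSeq (PSeq set_root_levels count_root_dominators) enqueue_roots.

Definition search : prog :=
  PSeq (PSeq (PSeq init (for_queue scan_nbrs)) count_outer_nbrs) (for_queue greedy_step).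

Definition attempt : prog := PSeq (PSeq search verify) settle.

Definition all_attempts : prog :=
  PFor guess1 (PFor guess2 (PFor guess3 (PFor guess4 attempt))).

Definition eds_prog : prog :=
  PSeq all_attempts (check_all outer_index verdict (Settled outer_index)).

Lemma wf_eds_prog : wf eds_prog. Proof. by []. Qed.

Section Correctness.

Variables (n : nat) (e : rel 'I_n).
Hypotheses (sym_e : symmetric e) (irr_e : irreflexive e).

Definition ready (s : state) : Prop :=
  regs s 0 = n /\ forall u v : 'I_n, mem s (u * n + v) = e u v.

Lemma matrix_index_lt (u v : 'I_n) : u * n + v < n * n.
Proof. by have := ltn_ord u; have := ltn_ord v; nia. Qed.

Lemma ready_input : ready (input e).
Proof.
split=> // u v; rewrite /= /adj_mem; congr nat_of_bool.
have n_gt0 : 0 < n by apply: leq_ltn_trans (ltn_ord u).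
apply/existsP/idP => [[u' /existsP[v' /andP[/eqP uv_eq uv]]]|uv]; last first.
  by exists u; apply/existsP; exists v; rewrite eqxx.
have -> : u = u'.
  apply: ord_inj; move/(congr1 (divn^~ n)): uv_eq.
  by rewrite !divnMDl // !divn_small // !addn0.
have -> // : v = v'.
by apply: ord_inj; move/(congr1 (modn^~ n)): uv_eq; rewrite !modnMDl !modn_small.
Qed.

Lemma ready_frame p s s' : wf p -> frame p s s' -> ready s -> ready s'.
Proof.
move=> wp [fr _ fl] [s0 adj]; split; first by rewrite fr ?wf_assigns0.
by move=> u v; rewrite fl ?adj // s0 matrix_index_lt.
Qed.

Lemma ready_sem p s : wf p -> ready s -> ready (sem p s).
Proof. by move=> wp; apply: (ready_frame wp (sem_frame s wp)). Qed.

Lemma ev_Adj s x y (u v : 'I_n) : ready s -> regs s x = u -> regs s y = v ->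
  ev s (Adj x y) = e u v.
Proof. by move=> [s0 adj] /= -> ->; rewrite s0 adj. Qed.

Lemma ev_InNbhd s x y (u v : 'I_n) : ready s -> regs s x = u -> regs s y = v ->
  ev s (InNbhd x y) = (u \in closed_nbhd e v).
Proof.
by move=> rs sx sy; rewrite ev_Or (ev_Adj rs sy sx) ev_Eq !ev_Reg !neq0b sx sy inE val_eqE.
Qed.

Lemma size_uniq_ord (q : seq 'I_n) : uniq q -> size q <= n.
Proof. by move=> /card_uniqP<-; rewrite -[X in _ <= X]card_ord max_card. Qed.

Definition levels (s : state) (v : 'I_n) : nat := arr s level_arr v.

Lemma ev_Level s x (v : 'I_n) : regs s x = v -> ev s (Level x) = levels s v.
Proof. by rewrite /Level ev_Cell ev_Reg => ->. Qed.

Definition queued (s : state) (q : seq 'I_n) : Prop :=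
  regs s queue_size = size q /\
  forall k, k < size q -> arr s queue_arr k = nth 0 (map (@nat_of_ord n) q) k.

Lemma enqueueP x (v : 'I_n) q s : regs s x = v -> queued s q ->
  queued (sem (enqueue x) s) (rcons q v).
Proof.
move=> sx [s_size s_q]; rewrite /enqueue sem_PSeq sem_PPut sem_PSet !evE.
split=> [|k]; first by rewrite /= /update s_size size_rcons addn1.
rewrite size_rcons ltnS arr_set_reg // arr_put // sx s_size map_rcons nth_rcons size_map.
by case: ltngtP => // kq _; apply: s_q.
Qed.

Lemma queued_frame p s s' q : frame p s s' -> ~~ assigns queue_size p ->
  ~~ writes queue_arr p -> queued s q -> queued s' q.
Proof.
move=> fr p_size p_q [s_size s_q]; split; first by rewrite (frame_reg fr).
by move=> k k_lt; rewrite (frame_arr fr) // s_q.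
Qed.

Lemma levels_frame p s s' : frame p s s' -> ~~ writes level_arr p -> levels s' =1 levels s.
Proof. by move=> fr p_lev v; rewrite /levels (frame_arr fr). Qed.

Lemma sem_queue_step p q (i : 'I_n) s : queued s q -> regs s outer_index = i ->
  sem (PIf (Op OpLt (Reg outer_index) (Reg queue_size))
    (PSeq (PSet current (Cell queue_arr (Reg outer_index))) p) PSkip) s =
  if i < size q then sem p (set_reg s current (nth i q i)) else s.
Proof.
move=> [s_size s_q] s_i; rewrite sem_PIf !evE neq0b s_i s_size; case: ltnP => // i_lt.
by rewrite sem_PSeq sem_PSet !evE s_i s_q // (nth_map i).
Qed.

Lemma count_root_dominatorsP (R : {set 'I_n}) s :
    ready s -> (forall v, levels s v = (v \in R)) ->
  forall t : 'I_n, arr (sem count_root_dominators s) dominators_arr t = dominators e R t.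
Proof.
move=> rs levR; apply: tabulateP => //; first by case: rs.
move=> i s' fr s'i _; have rs' : ready s' by apply: ready_frame fr rs.
rewrite ev_Reg (count_ifP (c := [pred t : 'I_n | t \in closed_nbhd e i :&: R])) //.
  by case: rs'.
move=> t s2 fr2 s2t; have rs2 : ready s2 by apply: ready_frame fr2 rs'.
have s2i : regs s2 outer_index = i by rewrite (frame_reg fr2).
rewrite ev_And (ev_InNbhd rs2 s2t s2i) (ev_Level s2t) !neq0b.
by rewrite (levels_frame fr2) // (levels_frame fr) // levR neq0b !inE andbC.
Qed.

Lemma enqueue_rootsP (R : {set 'I_n}) s : ready s -> (forall v, levels s v = (v \in R)) ->
  exists q, [/\ queued (sem enqueue_roots s) q, uniq q & q =i R].
Proof.
move=> rs levR.
pose Inv k s' := exists q, [/\ queued s' q, uniq q & q =i [set v in R | v < k]].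
suff [q [s_q uniq_q qR]] : Inv n (sem enqueue_roots s).
  by exists q; split=> // v; rewrite qR inE ltn_ord andbT.
apply: sem_init_for => //; first by case: rs.
  by exists [::]; split=> // v; rewrite !inE andbF.
move=> i s' fr s'i [q [s'_q uniq_q qR]].
rewrite sem_PIf (ev_Level s'i) (levels_frame fr) // levR neq0b; case: ifP => iR.
  exists (rcons q i); split; first exact: enqueueP.
    by rewrite rcons_uniq uniq_q qR inE ltnn andbF.
  move=> v; rewrite mem_rcons in_cons qR 2!in_set ltS_ord.
  by case: eqP => [->|]; rewrite ?iR.
exists q; split=> // v; rewrite qR 2!in_set ltS_ord.
by case: eqP => [->|]; rewrite ?iR.
Qed.

Lemma scan_nbrsP (R : {set 'I_n}) done (u : 'I_n) todo s :
    ready s -> regs s current = u ->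
    queued s (done ++ u :: todo) -> bfs_inv e R done (u :: todo) (levels s) ->
  exists todo', let s' := sem scan_nbrs s in
  queued s' (rcons done u ++ todo') /\ bfs_inv e R (rcons done u) todo' (levels s').
Proof.
move=> rs s_u s_q bfs_s.
pose Inv k s' := exists todo', [/\ queued s' (done ++ u :: todo'),
  bfs_inv e R done (u :: todo') (levels s')
  & forall v : 'I_n, v < k -> e u v -> 0 < levels s' v].
suff [todo' [s'_q bfs_s' scanned]] : Inv n (sem scan_nbrs s).
  exists todo'; rewrite cat_rcons; split=> //.
  by apply: bfs_next bfs_s' _ => v; apply: scanned.
apply: sem_for => //; [by case: rs | by exists todo|].
move=> v s' fr s'v [todo' [s'_q bfs_s' scanned]].
have rs' : ready s' by apply: ready_frame fr rs.
have s'u : regs s' current = u by rewrite (frame_reg fr).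
rewrite sem_PIf ev_And ev_Not (ev_Adj rs' s'u s'v) (ev_Level s'v) !neq0b.
case: ifP => [/andP[uv /eqP v0]|skip]; last first.
  exists todo'; split=> // t; rewrite ltS_ord => /orP[/eqP->|]; last exact: scanned.
  by move: skip; rewrite lt0n; case: (e u v) => //= ->.
set p := PPut _ _ _; rewrite sem_PSeq; set s1 := sem p s'.
have wp : wf p by []; have fr1 := sem_frame s' wp.
have s1v : regs s1 inner_index = v by [].
have wq : wf (enqueue inner_index) by []; have fr2 := sem_frame s1 wq.
have levE t : levels (sem (enqueue inner_index) s1) t =
    if t == v then (levels s' u).+1 else levels s' t.
  rewrite (levels_frame fr2) // /s1 /p sem_PPut /levels arr_put // eqxx ev_Reg s'v val_eqE.
  by rewrite ev_Add (ev_Level s'u) ev_Const addn1.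
exists (rcons todo' v); rewrite -rcons_cons -rcons_cat; split.
- by apply: enqueueP => //; apply: queued_frame fr1 _ _ s'_q.
- by rewrite rcons_cons; apply: bfs_push bfs_s' uv v0 levE.
move=> t; rewrite ltS_ord levE; case: eqP => //= _; exact: scanned.
Qed.

Lemma bfsP (R : {set 'I_n}) q0 s : ready s ->
    queued s q0 -> bfs_inv e R [::] q0 (levels s) ->
  exists q, let s' := sem (for_queue scan_nbrs) s in
  queued s' q /\ bfs_inv e R q [::] (levels s').
Proof.
move=> rs s_q bfs_s.
pose Inv k s' := exists q, queued s' q /\ bfs_inv e R (take k q) (drop k q) (levels s').
suff [q [s'_q bfs_s']] : Inv n (sem (for_queue scan_nbrs) s).
  have size_q : size q <= n.
    by apply: size_uniq_ord; have := bfs_uniq bfs_s'; rewrite cat_take_drop.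
  by exists q; move: bfs_s'; rewrite take_oversize ?drop_oversize.
apply: sem_for => //; [by case: rs | by exists q0; rewrite take0 drop0|].
move=> i s' fr s'i [q [s'_q bfs_s']]; have rs' : ready s' by apply: ready_frame fr rs.
rewrite (sem_queue_step _ s'_q s'i); case: ltnP => [i_lt|i_ge]; last first.
  exists q; split=> //.
  by move: bfs_s'; rewrite !take_oversize ?drop_oversize // ltnW.
rewrite (drop_nth i) // in bfs_s'; set u := nth i q i in bfs_s' *.
have q_split : q = take i q ++ u :: drop i.+1 q by rewrite -drop_nth ?cat_take_drop.
have [||todo' [s1_q bfs_s1]] := scan_nbrsP (s := set_reg s' current u) _ erefl _ bfs_s'.
- exact: rs'.
- by rewrite -q_split.
exists (rcons (take i q) u ++ todo').
by rewrite take_size_cat ?drop_size_cat // size_rcons size_takel // ltnW.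
Qed.

Lemma count_outer_nbrsP s : ready s -> forall v : 'I_n,
  arr (sem count_outer_nbrs s) outer_degree_arr v = #|outer_nbrs e (levels s) v|.
Proof.
move=> rs; apply: tabulateP => //; first by case: rs.
move=> i s' fr s'i _; have rs' : ready s' by apply: ready_frame fr rs.
rewrite ev_Reg (count_ifP (c := [in outer_nbrs e (levels s) i])) //; first by case: rs'.
move=> t s2 fr2 s2t; have rs2 : ready s2 by apply: ready_frame fr2 rs'.
have s2i : regs s2 outer_index = i by rewrite (frame_reg fr2).
rewrite ev_And ev_Not ev_Lt (ev_Adj rs2 s2i s2t) (ev_Level s2t) (ev_Level s2i) !neq0b eqb0.
by rewrite !(levels_frame fr2) // !(levels_frame fr) // inE -leqNgt.
Qed.

Definition dominators_stored (s : state) (P : {set 'I_n}) : Prop :=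
  forall t : 'I_n, arr s dominators_arr t = dominators e P t.

Lemma add_dominatorP (P : {set 'I_n}) (v : 'I_n) s :
    ready s -> regs s chosen = v -> v \notin P -> dominators_stored s P ->
  dominators_stored (sem add_dominator s) (v |: P).
Proof.
move=> rs s_v vP domP; apply: tabulateP => //; first by case: rs.
move=> i s' fr s'i old; have rs' : ready s' by apply: ready_frame fr rs.
have s'v : regs s' chosen = v by rewrite (frame_reg fr).
rewrite sem_PSkip ev_Add (ev_InNbhd rs' s'i s'v) /Dominators ev_Cell ev_Reg s'i old domP.
by rewrite dominatorsU1.
Qed.

Lemma dominators_stored_frame p s s' (P : {set 'I_n}) :
    frame p s s' -> ~~ writes dominators_arr p ->
  dominators_stored s P -> dominators_stored s' P.
Proof. by move=> fr p_dom domP t; rewrite (frame_arr fr) // domP. Qed.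

Lemma choose_candidateP (P : {set 'I_n}) lev (w : 'I_n) s :
    ready s -> regs s current = w -> levels s =1 lev -> dominators_stored s P ->
  let b := regs (sem choose_candidate s) chosen in
  (b = n /\ forall v, ~~ candidate e P lev w v) \/
  exists v : 'I_n, [/\ b = v, candidate e P lev w v
    & forall t, candidate e P lev w t ->
        arr s outer_degree_arr v <= arr s outer_degree_arr t].
Proof.
move=> rs s_w levE domP; apply: argminP => //; first by case: rs.
move=> v s' fr s'v; have rs' : ready s' by apply: ready_frame fr rs.
have s'w : regs s' current = w by rewrite (frame_reg fr).
rewrite !ev_And ev_Not ev_Eq ev_Add (ev_Adj rs' s'w s'v) (ev_Level s'v) (ev_Level s'w).
rewrite ev_Const addn1 !neq0b !(levels_frame fr) // !levE /Dominators ev_Cell ev_Reg s'v.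
by rewrite (dominators_stored_frame fr isT domP) -andbA.
Qed.

Lemma greedy_stepP (R P : {set 'I_n}) lev done (w : 'I_n) s :
    ready s -> regs s current = w -> levels s =1 lev -> dominators_stored s P ->
    (forall v : 'I_n, arr s outer_degree_arr v = #|outer_nbrs e lev v|) ->
    level_function e R lev -> 0 < lev w -> (forall t, 0 < lev t < lev w -> t \in done) ->
  exists P', dominators_stored (sem greedy_step s) P' /\
    forall D, recoverable e D R -> partial_recovery e D R P done ->
      partial_recovery e D R P' (rcons done w).
Proof.
move=> rs s_w levE domP outerE lf w_gt0 below.
rewrite sem_PIf /Dominators ev_Cell ev_Reg s_w domP.
case: ifP => [dom_w|/negbFE/eqP undom_w].
  by exists P; split=> // D _ recP; apply: partial_recovery_rcons; rewrite ?lt0n.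
have wfc : wf choose_candidate by [].
have fr := sem_frame s wfc; have rs1 := ready_sem wfc rs.
rewrite sem_PSeq sem_PIf ev_Lt !ev_Reg neq0b; have [-> _] := rs1.
have [[-> none]|[v [s1v cand_v min_v]]] := choose_candidateP rs s_w levE domP.
  exists P; rewrite ltnn; split; first exact: dominators_stored_frame fr _ domP.
  move=> D recD recP; have [v] := exists_candidate recD recP lf w_gt0 below undom_w.
  by rewrite (negbTE (none v)).
have vP : v \notin P.
  case/and3P: cand_v => _ /eqP undom_v _.
  exact: dominators_eq0 undom_v (closed_nbhd_refl _ _).
exists (v |: P); rewrite s1v ltn_ord; split.
  by apply: add_dominatorP; rewrite ?s1v //; apply: dominators_stored_frame fr _ domP.
move=> D recD recP.
apply: (partial_recovery_add irr_e recD recP lf w_gt0 below undom_w) => // t cand_t.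
by rewrite -!outerE min_v.
Qed.

Lemma greedyP (R : {set 'I_n}) q lev s :
    ready s -> queued s q -> levels s =1 lev -> bfs_inv e R q [::] lev ->
    (forall v : 'I_n, arr s outer_degree_arr v = #|outer_nbrs e lev v|) ->
    dominators_stored s R ->
  exists P, dominators_stored (sem (for_queue greedy_step) s) P /\
    forall D, recoverable e D R -> partial_recovery e D R P q.
Proof.
move=> rs s_q levE bfs_s outerE domR; have lf := bfs_level bfs_s.
pose Inv k s' := exists P, dominators_stored s' P /\
  forall D, recoverable e D R -> partial_recovery e D R P (take k q).
suff [P [domP recP]] : Inv n (sem (for_queue greedy_step) s).
  exists P; split=> //; move: recP; rewrite take_oversize // size_uniq_ord //.
  by have := bfs_uniq bfs_s; rewrite cats0.
apply: sem_for => //; first by case: rs.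
  exists R; split=> // D [_ RD _]; split=> // t; by rewrite take0.
move=> i s' fr s'i [P [domP recP]]; have rs' : ready s' by apply: ready_frame fr rs.
rewrite (sem_queue_step _ (queued_frame fr isT isT s_q) s'i).
case: ltnP => [i_lt|i_ge]; last first.
  by exists P; split=> // D /recP; rewrite !take_oversize // ltnW.
set w := nth i q i; set s1 := set_reg s' current w.
have wq : w \in q by apply: mem_nth.
have q_split : q = take i q ++ w :: drop i.+1 q by rewrite -drop_nth ?cat_take_drop.
have w_gt0 : 0 < lev w by rewrite (bfs_reached bfs_s) cats0.
have below t : 0 < lev t < lev w -> t \in take i q := bfs_before bfs_s q_split.
have [P' [domP' addP]] : exists P', dominators_stored (sem greedy_step s1) P' /\
    forall D, recoverable e D R -> partial_recovery e D R P (take i q) ->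
      partial_recovery e D R P' (rcons (take i q) w).
  apply: (greedy_stepP (lev := lev)) => //.
  - by move=> t; rewrite -levE; apply: (levels_frame fr).
  - by move=> v; rewrite -outerE; apply: (frame_arr fr).
exists P'; split=> // D recD; rewrite (take_nth i) //; apply: addP => //; exact: recP.
Qed.

Lemma verifyP (P : {set 'I_n}) lev s :
    ready s -> levels s =1 lev -> dominators_stored s P ->
  (regs (sem verify s) verdict != 0) = [forall v, (0 < lev v) ==> (dominators e P v == 1)].
Proof.
move=> rs levE domP; apply: check_allP => //; first by case: rs.
move=> v s' fr s'v; rewrite ev_Or ev_Not ev_Eq (ev_Level s'v) (levels_frame fr) // levE.
rewrite /Dominators ev_Cell ev_Const ev_Reg s'v (dominators_stored_frame fr isT domP).
by rewrite !neq0b lt0n implybE negbK.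
Qed.

Definition settled (s : state) (v : 'I_n) : bool := arr s settled_arr v != 0.

Lemma settleP s v : ready s ->
  settled (sem settle s) v = settled s v || ((regs s verdict != 0) && (0 < levels s v)).
Proof.
move=> rs; pose f t : nat := settled s t || ((regs s verdict != 0) && (0 < levels s t)).
suff settleE (t : 'I_n) : arr (sem settle s) settled_arr t = f t.
  by rewrite /settled settleE neq0b.
apply: tabulateP t => //; first by case: rs.
move=> i s' fr s'i old; rewrite sem_PSkip ev_Or ev_And (ev_Level s'i) (levels_frame fr) //.
by rewrite /Settled ev_Cell !ev_Reg s'i old (frame_reg fr) // neq0b /f lt0n.
Qed.

Record progress (X : 'I_n -> Prop) (s s' : state) : Prop := Progress {
  progress_mono : forall v, settled s v -> settled s' v;
  progress_sound : forall v, settled s' v -> settled s v \/ locally_dominated e v;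
  progress_covers : forall v, X v -> settled s' v
}.

Definition recovered (R : {set 'I_n}) (v : 'I_n) : Prop :=
  (exists D, recoverable e D R) /\ exists2 r, r \in R & connect e r v.

Section Attempt.

Variables a b c d : 'I_n.
Let R : {set 'I_n} := [set a; b; c; d].

Definition guessed (s : state) : Prop :=
  [/\ regs s guess1 = a, regs s guess2 = b, regs s guess3 = c & regs s guess4 = d].

Lemma set_root_levelsP s : ready s -> guessed s ->
  forall v, levels (sem set_root_levels s) v = (v \in R).
Proof.
move=> rs [s1 s2 s3 s4]; apply: tabulateP => //; first by case: rs.
move=> i s' fr s'i _; rewrite sem_PSkip /IsGuess !evE s'i !(frame_reg fr) // !neq0b.
by rewrite s1 s2 s3 s4 !val_eqE !inE.
Qed.

Lemma initP s : ready s -> guessed s -> let s' := sem init s in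
  exists q, [/\ queued s' q, bfs_inv e R [::] q (levels s') & dominators_stored s' R].
Proof.
move=> rs gs; have lev1 := set_root_levelsP rs gs; rewrite /init 2!sem_PSeq.
have wf1 : wf set_root_levels by [].
have rs1 := ready_sem wf1 rs; set s1 := sem set_root_levels s in lev1 rs1 *.
have dom2 := count_root_dominatorsP rs1 lev1.
have wf2 : wf count_root_dominators by [].
have fr2 := sem_frame s1 wf2; have rs2 := ready_sem wf2 rs1.
set s2 := sem count_root_dominators s1 in dom2 fr2 rs2 *.
have lev2 v : levels s2 v = (v \in R) by rewrite (levels_frame fr2) // lev1.
have [q [s3_q uniq_q qR]] := enqueue_rootsP rs2 lev2.
have wf3 : wf enqueue_roots by []; have fr3 := sem_frame s2 wf3.
exists q; split=> //; last exact: dominators_stored_frame fr3 _ dom2.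
by apply: bfs_init => // v; rewrite (levels_frame fr3) // lev2.
Qed.

Lemma searchP s : ready s -> guessed s -> let s' := sem search s in
  exists lev P, [/\ levels s' =1 lev, level_function e R lev, dominators_stored s' P
    & forall D, recoverable e D R ->
        P \subset D /\ forall v, 0 < lev v -> 0 < dominators e P v].
Proof.
move=> rs gs; have [q0 [s1_q bfs1 dom1]] := initP rs gs; rewrite /search 3!sem_PSeq.
have wf1 : wf init by [].
have rs1 := ready_sem wf1 rs; set s1 := sem init s in s1_q bfs1 dom1 rs1 *.
have [q [s2_q bfs2]] := bfsP rs1 s1_q bfs1.
have wf2 : wf (for_queue scan_nbrs) by [].
have fr2 := sem_frame s1 wf2; have rs2 := ready_sem wf2 rs1.
set s2 := sem (for_queue _) s1 in s2_q bfs2 fr2 rs2 *.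
have outer3 := count_outer_nbrsP rs2; have wf3 : wf count_outer_nbrs by [].
have fr3 := sem_frame s2 wf3; have rs3 := ready_sem wf3 rs2.
set s3 := sem count_outer_nbrs s2 in outer3 fr3 rs3 *.
have lev3 := levels_frame fr3 isT.
have [P [dom4 recP]] := greedyP rs3 (queued_frame fr3 isT isT s2_q) lev3 bfs2 outer3
  (dominators_stored_frame fr3 isT (dominators_stored_frame fr2 isT dom1)).
have wf4 : wf (for_queue greedy_step) by []; have fr4 := sem_frame s3 wf4.
exists (levels s2), P; split=> //.
- by move=> v; rewrite (levels_frame fr4) // lev3.
- exact: bfs_level bfs2.
move=> D /recP[_ PD dom]; split=> // v.
by rewrite (bfs_reached bfs2) cats0; apply: dom.
Qed.

Lemma attempt_progress s : ready s -> guessed s ->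
  progress (recovered R) s (sem attempt s).
Proof.
move=> rs gs; have [lev [P [lev1 lf dom1 recP]]] := searchP rs gs.
have wf1 : wf search by []; have rs1 := ready_sem wf1 rs.
have wf2 : wf (PSeq search verify) by []; have rs2 := ready_sem wf2 rs.
have fr2 := sem_frame s wf2.
have settledE v : settled (sem attempt s) v = settled s v ||
    ([forall t, (0 < lev t) ==> (dominators e P t == 1)] && (0 < lev v)).
  rewrite /attempt sem_PSeq settleP // /settled (frame_arr fr2) // sem_PSeq.
  rewrite (verifyP rs1 lev1 dom1).
  by rewrite (levels_frame (sem_frame _ (isT : wf verify))) // lev1.
have closedL := level_closed sym_e lf.
split=> v; rewrite settledE.
- by move->.
- case/orP=> [->|/andP[/forallP exact_P v_gt0]]; [by left | right].
  exists [set t | 0 < lev t], P; split=> // [|t]; rewrite inE // => t_gt0.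
  by apply/eqP; apply: implyP (exact_P t) t_gt0.
case=> -[D recD] [r rR rv]; have [edsD _ _] := recD; have [PD dom] := recP D recD.
apply/orP; right; apply/andP; split.
  apply/forall_inP => t t_gt0; apply/eqP.
  exact: (dominators_sub_eds edsD PD (dom t t_gt0)).
have := closed_connect closedL rv; rewrite !inE => <-.
by rewrite (level_root lf rR).
Qed.

End Attempt.

Lemma for_progress x p (X : 'I_n -> 'I_n -> Prop) s : wf (PFor x p) -> ready s ->
    (forall (i : 'I_n) s', frame (PFor x p) s s' -> ready s' -> regs s' x = i ->
       progress (X i) s' (sem p s')) ->
  progress (fun v => exists i, X i v) s (sem (PFor x p) s).
Proof.
move=> wfx rs body; have x0 : x != 0 by case/and3P: wfx.
pose Inv k s' := progress (fun v => exists2 i : 'I_n, i < k & X i v) s s'.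
suff [mono sound covers] : Inv n (sem (PFor x p) s).
  by split=> // v [i Xiv]; apply: covers; exists i.
apply: sem_for => //; first by case: rs.
- move=> k s' v [mono sound covers].
  split=> t; rewrite /settled arr_set_reg //.
  - exact: mono.
  - exact: sound.
  exact: covers.
- by split=> // v; [left | case].
move=> i s' fr s'i [mono sound covers]; have rs' : ready s' by apply: ready_frame fr rs.
have [mono_i sound_i covers_i] := body i s' fr rs' s'i.
split=> [v /mono/mono_i //|v /sound_i[/sound|]|v [t]]; [by [] | by right |].
rewrite ltS_ord => /orP[/eqP->|ti Xtv]; first exact: covers_i.
by apply/mono_i/covers; exists t.
Qed.

Lemma all_attempts_progress s : ready s ->
  progress (fun v => exists a b c d, recovered [set a; b; c; d] v) s (sem all_attempts s).
Proof.
move=> rs; apply: for_progress => // a s1 _ rs1 r1.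
apply: for_progress => // b s2 fr2 rs2 r2.
apply: for_progress => // c s3 fr3 rs3 r3.
apply: for_progress => // d s4 fr4 rs4 r4.
apply: attempt_progress => //; split=> //; last by rewrite (frame_reg fr4).
  by rewrite (frame_reg fr4) // (frame_reg fr3) // (frame_reg fr2).
by rewrite (frame_reg fr4) // (frame_reg fr3).
Qed.

Lemma settled_input v : settled (input e) v = false.
Proof.
apply/negbTE; rewrite /settled /arr /= /adj_mem neq0b; apply/existsP=> -[i /existsP[j]].
by case/andP=> /eqP; have := matrix_index_lt i j; lia.
Qed.

Lemma eds_prog_accepts :
  regs (sem eds_prog (input e)) verdict <> 0 <->
  forall v, settled (sem all_attempts (input e)) v.
Proof.
have rs := ready_sem (isT : wf all_attempts) ready_input.
rewrite /eds_prog sem_PSeq; set s := sem all_attempts _ in rs *.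
set check := check_all _ _ _.
have checkE : (regs (sem check s) verdict != 0) = [forall v, settled s v].
  apply: check_allP => //; first by case: rs.
  by move=> v s' fr s'v; rewrite /Settled ev_Cell ev_Reg s'v (frame_arr fr).
split=> [/eqP|all_v]; first by rewrite checkE => /forallP.
by apply/eqP; rewrite checkE; apply/forallP.
Qed.

Lemma eds_prog_correct : bipartite e -> induced_free (spider 2 2 4) e ->
  regs (sem eds_prog (input e)) verdict <> 0 <-> has_eds e.
Proof.
move=> [A color] spider_free; rewrite eds_prog_accepts.
have [_ sound covers] := all_attempts_progress ready_input.
split=> [all_v|[D edsD] v].
  apply: (local_to_global_eds sym_e) => v.
  by have [|//] := sound v (all_v v); rewrite settled_input.
have [a [b [c [d [RD av unamb]]]]] :=
  exists_unambiguous sym_e irr_e spider_free color edsD v.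
apply: covers; exists a, b, c, d; split; first by exists D.
by exists a; rewrite // !inE eqxx.
Qed.

End Correctness.

Theorem theorem8 :
  solvable_in_time
    (fun n (e : rel 'I_n) => bipartite e /\ induced_free (spider 2 2 4) e)
    (fun n (e : rel 'I_n) => has_eds e)
    (fun n => n ^ 6).
Proof.
apply: (solvable_by_prog (p := eds_prog) (x := verdict) wf_eds_prog).
by move=> n e [sym_e irr_e] [bip spider_free]; apply: eds_prog_correct.
Qed.
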